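(* The normal pseudo-distance $d_N$ is a Riemannian Morita invariant, i.e. it depends only on the Riemannian stack $([M/G],[\eta])$: if $(G\rightrightarrows M,\eta)$ and $(G'\rightrightarrows M',\eta')$ are Riemannian groupoids presenting the same Riemannian stack, meaning that there are a Riemannian groupoid $(H\rightrightarrows N,\eta_H)$ and Riemannian Morita maps $\phi:H\to G$ and $\phi':H\to G'$, then the bijection $[\phi']\circ[\phi]^{-1}:M/G\to M'/G'$ between coarse orbit spaces preserves $d_N$.
   Context: Lie groupoids: $G\rightrightarrows M$ has manifolds $M$ of objects and $G$ of arrows ($G$ possibly non-Hausdorff), surjective submersions $s,t:G\to M$ (source, target), a smooth multiplication $m$ on $G^{(2)}=\{(g,h):s(g)=t(h)\}$, units and inverses. $O_x\subset M$ is the orbit of $x$, $G_x=s^{-1}(x)\cap t^{-1}(x)$ the isotropy group, $M/G$ the coarse orbit space with the quotient topology, $[x]\in M/G$ the class of $x$, and $N_xO=T_xM/T_xO_x$. A map of Lie groupoids $f:(H\rightrightarrows N)\to(G\rightrightarrows M)$ is a smooth functor; it induces $[f]:N/H\to M/G$, $f_x:H_x\to G_{f(x)}$ and $[d_xf]:N_xO\to N_{f(x)}O$. It is Morita if $[f]$ is a homeomorphism and all $f_x$ and $[d_xf]$ are isomorphisms. A differentiable stack is a Lie groupoid up to Morita equivalence (existence of a third groupoid with Morita maps to both). Riemannian groupoids: a metric on the total space of a submersion is transverse to the submersion if it descends to a metric on the base making it a Riemannian submersion. A groupoid metric on $G\rightrightarrows M$ is a Riemannian metric $\eta=\eta^{(2)}$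 on $G^{(2)}$, invariant under the $S_3$-action that permutes the vertices of commutative triangles (generated by $(g,h)\mapsto(h^{-1},g^{-1})$ and $(g,h)\mapsto(gh,h^{-1})$), and transverse to $m$. It induces metrics $\eta^{(1)}$ on $G$ and $\eta^{(0)}$ on $M$ for which $m$ and the two projections $G^{(2)}\to G$, and $s,t:G\to M$, are Riemannian submersions. A Riemannian groupoid is a Lie groupoid with a groupoid metric. $\eta^{(0)}$ induces inner products on the spaces $N_xO\cong (T_xO_x)^\perp$. A Riemannian Morita map is a Morita map between Riemannian groupoids such that all $[d_xf]:N_xO\to N_{f(x)}O$ are isometries. Two groupoid metrics on $G\rightrightarrows M$ are equivalent if they induce the same inner products on all $N_xO$ (i.e. the identity is a Riemannian Morita map); a stacky metric $[\eta]$ is an equivalence class. Normal pseudo-distance: let $d$ be the Riemannian distance of $\eta^{(0)}$ on each component of $M$. A chain from $x$ to $y$ is a sequence $(x_0,\dots,x_{2n+1})$ in $M$ with $x_0=x$, $x_{2n+1}=y$, $x_{2i},x_{2i+1}$ in the same orbit, and $x_{2i-1},x_{2i}$ in the same component of $M$. Then $d_N([x],[y])=\inf\{\sum_{i=1}^n d(x_{2i-1},x_{2i})\}$ over all chains from $x$ to $y$ (with value $+\infty$ if there is no chain, which does not happen when $M/G$ is connected). *)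

(* Defs.v *)
From HB Require Import structures.
From mathcomp Require Import all_boot all_order all_algebra.
From mathcomp Require Import generic_quotient.
From mathcomp Require Import all_classical all_reals all_analysis.
Import Order.TTheory GRing.Theory Num.Theory numFieldNormedType.Exports.

Set Implicit Arguments.
Unset Strict Implicit.
Unset Printing Implicit Defensive.

Local Open Scope quotient_scope.
Local Open Scope classical_set_scope.
Local Open Scope ring_scope.

(* C^oo on U, which is always an open set below. *)
Definition smooth_on {R : realType} {V W : normedModType R}
    (U : set V) (f : V -> W) : Prop :=
  forall (vs : seq V) (x : V), U x ->
    differentiable (foldr (fun v g => 'D_v g) f vs) x.

(* The values of cmap outside cdom, and of cinv outside cmap @` cdom, are
   irrelevant. *)
Record chart (R : realType) (T : topologicalType) (n : nat) := Chart {
  cdom : set T;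
  cmap : T -> 'rV[R]_n;
  cinv : 'rV[R]_n -> T;
  cdom_open : open cdom;
  cimg_open : open (cmap @` cdom);
  cmapK : {in cdom, cancel cmap cinv};
  cmap_continuous : forall x, cdom x -> {for x, continuous cmap};
  cinv_continuous : forall p, (cmap @` cdom) p -> {for p, continuous cinv} }.

(* An atlas with one distinguished chart around each point. A chart of the
   smooth structure being chosen at every point, this is no restriction, and it
   lets us take 'rV_dim as the tangent space at x: a tangent vector at x is
   represented by its coordinates in the chart chart_at x. *)
Record smoothStructure (R : realType) (T : topologicalType) := SmoothStructure {
  dim : nat;
  chart_at : T -> chart R T dim;
  mem_chart_at : forall x, cdom (chart_at x) x;
  chart_compat : forall x y,
    smooth_on (cmap (chart_at x) @` (cdom (chart_at x) `&` cdom (chart_at y)))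
              (cmap (chart_at y) \o cinv (chart_at x)) }.

(* Neither Hausdorff nor second countable by itself: see lieGroupoid. *)
Record manifold (R : realType) := Manifold {
  mcarrier :> topologicalType;
  mstruct : smoothStructure R mcarrier }.

Definition mdim {R : realType} (M : manifold R) : nat := dim (mstruct M).

Definition mchart {R : realType} (M : manifold R) (x : M) :
  chart R M (mdim M) := chart_at (mstruct M) x.

Definition smooth_map_on {R : realType} {M N : manifold R}
    (U : set M) (f : M -> N) : Prop :=
  (forall x, U x -> {for x, continuous f}) /\
  forall (x : M) (y : N),
    smooth_on
      (cmap (mchart x) @` (U `&` cdom (mchart x) `&` f @^-1` cdom (mchart y)))
      (cmap (mchart y) \o f \o cinv (mchart x)).

Definition smooth_map {R : realType} {M N : manifold R} (f : M -> N) : Prop :=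
  smooth_map_on setT f.

(* Smoothness on an arbitrary subset: local extendability. For an embedded
   submanifold A this is smoothness for the submanifold structure. *)
Definition smooth_map_on_subset {R : realType} {M N : manifold R}
    (A : set M) (f : M -> N) : Prop :=
  forall a, A a -> exists (U : set M) (F : M -> N),
    [/\ open U, U a, smooth_map_on U F & forall x, A x -> U x -> F x = f x].

(* d_x f : T_x M -> T_(f x) N, acting on row vectors by v |-> v *m mfd f x. *)
Definition mfd {R : realType} {M N : manifold R} (f : M -> N) (x : M) :
    'M[R]_(mdim M, mdim N) :=
  jacobian (cmap (mchart (f x)) \o f \o cinv (mchart x)) (cmap (mchart x) x).

Definition submersion {R : realType} {M N : manifold R} (f : M -> N) : Prop :=
  smooth_map f /\ forall x, row_full (mfd f x).

Definition inner {R : realType} {n : nat} (A : 'M[R]_n) (v w : 'rV[R]_n) : R :=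
  (v *m A *m w^T) 0 0.

(* metric x is the Gram matrix of the inner product of T_x M (in the chart at
   x); metric_smooth says that its expression in each chart is smooth. *)
Record riemMetric (R : realType) (M : manifold R) := RiemMetric {
  metric :> M -> 'M[R]_(mdim M);
  metric_sym : forall x, (metric x)^T = metric x;
  metric_pos : forall x v, v != 0 -> 0 < inner (metric x) v v;
  metric_smooth : forall x : M,
    smooth_on (cmap (mchart x) @` cdom (mchart x))
      (fun p => let y := cinv (mchart x) p in
                let J := jacobian (cmap (mchart y) \o cinv (mchart x)) p in
                J *m metric y *m J^T) }.

Definition isometric_at {R : realType} {M N : manifold R}
    (gM : riemMetric M) (gN : riemMetric N) (f : M -> N) (x : M) : Prop :=
  forall v w, inner (gN (f x)) (v *m mfd f x) (w *m mfd f x)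
              = inner (gM x) v w.

Definition riem_submersion {R : realType} {M N : manifold R}
    (gM : riemMetric M) (gN : riemMetric N) (f : M -> N) : Prop :=
  submersion f /\
  forall x v w,
    (forall k, k *m mfd f x = 0 -> inner (gM x) v k = 0) ->
    (forall k, k *m mfd f x = 0 -> inner (gM x) w k = 0) ->
    inner (gN (f x)) (v *m mfd f x) (w *m mfd f x) = inner (gM x) v w.

Definition smooth_curve_on {R : realType} {M : manifold R}
    (U : set R) (gamma : R -> M) : Prop :=
  (forall t, U t -> {for t, continuous gamma}) /\
  forall x : M, smooth_on (U `&` gamma @^-1` cdom (mchart x))
                          (cmap (mchart x) \o gamma : R^o -> 'rV[R]_(mdim M)).

Definition velocity {R : realType} {M : manifold R} (gamma : R -> M) (t : R) :
    'rV[R]_(mdim M) :=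
  derive1 (cmap (mchart (gamma t)) \o gamma) t.

Definition curve_length {R : realType} {M : manifold R} (g : riemMetric M)
    (gamma : R -> M) : R :=
  \int[lebesgue_measure]_(t in `[0%R, 1%R])
     Num.sqrt (inner (g (gamma t)) (velocity gamma t) (velocity gamma t)).

(* pw_path_length g x y L: some piecewise smooth path from x to y, i.e. a
   concatenation of smooth curves parametrized by [0, 1], has length L. *)
Inductive pw_path_length {R : realType} {M : manifold R} (g : riemMetric M)
    (x : M) : M -> R -> Prop :=
| pw_path_nil : pw_path_length g x x 0
| pw_path_snoc (L : R) (gamma : R -> M) (U : set R) :
    open U -> `[0, 1] `<=` U -> smooth_curve_on U gamma ->
    pw_path_length g x (gamma 0) L ->
    pw_path_length g x (gamma 1) (L + curve_length g gamma).

(* +oo if x and y lie in different components. *)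
Definition riem_dist {R : realType} {M : manifold R} (g : riemMetric M)
    (x y : M) : \bar R :=
  ereal_inf [set L%:E | L in pw_path_length g x y].

(* The pairs (g, h) with s(g) = t(h), with the subspace topology of G * G. *)
Definition composable {R : realType} {G M : manifold R} (s t : G -> M) :
    topologicalType :=
  set_type [set gh : G * G | s gh.1 = t gh.2].

Definition cfst {R : realType} {G M : manifold R} {s t : G -> M}
  (p : composable s t) : G := (set_val p).1.

Definition csnd {R : realType} {G M : manifold R} {s t : G -> M}
  (p : composable s t) : G := (set_val p).2.

Definition cpair {R : realType} {G M : manifold R} {s t : G -> M}
    (g h : G) (e : s g = t h) : composable s t :=
  exist _ (g, h) (mem_set (e : [set gh : G * G | s gh.1 = t gh.2] (g, h))).

Lemma composableP {R : realType} {G M : manifold R} {s t : G -> M}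
  (p : composable s t) : s (cfst p) = t (csnd p).
Proof. exact: set_valP p. Qed.

(* comp_struct is the structure of embedded submanifold of G * G on G^(2):
   the inclusion (cfst, csnd) is a topological embedding by definition of
   composable, and it is required to be an immersion. The manifold of arrows is
   not required to be Hausdorff.
   mul_assoc: p = (g, h), q = (h, k), p' = (gh, k), q' = (g, hk). *)
Record lieGroupoid (R : realType) := LieGroupoid {
  obj : manifold R;
  arr : manifold R;
  obj_hausdorff : hausdorff_space obj;
  obj_second_countable : @second_countable obj;
  arr_second_countable : @second_countable arr;
  src : arr -> obj;
  tgt : arr -> obj;
  src_submersion : submersion src;
  tgt_submersion : submersion tgt;
  src_surj : forall x, exists g, src g = x;
  tgt_surj : forall x, exists g, tgt g = x;
  comp_struct : smoothStructure R (composable src tgt);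
  comp := Manifold comp_struct;
  cfst_smooth : smooth_map (cfst : comp -> arr);
  csnd_smooth : smooth_map (csnd : comp -> arr);
  comp_immersion : forall (p : comp) (v : 'rV[R]_(mdim comp)),
    v *m mfd (cfst : comp -> arr) p = 0 ->
    v *m mfd (csnd : comp -> arr) p = 0 -> v = 0;
  mul : comp -> arr;
  unit : obj -> arr;
  inv : arr -> arr;
  mul_smooth : smooth_map mul;
  unit_smooth : smooth_map unit;
  inv_smooth : smooth_map inv;
  src_mul : forall p, src (mul p) = src (csnd p);
  tgt_mul : forall p, tgt (mul p) = tgt (cfst p);
  src_unit : forall x, src (unit x) = x;
  tgt_unit : forall x, tgt (unit x) = x;
  src_inv : forall g, src (inv g) = tgt g;
  tgt_inv : forall g, tgt (inv g) = src g;
  mul_assoc : forall p q p' q' : comp,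
    csnd p = cfst q ->
    cfst p' = mul p -> csnd p' = csnd q ->
    cfst q' = cfst p -> csnd q' = mul q ->
    mul p' = mul q';
  mul_unit_l : forall (p : comp) x, cfst p = unit x -> mul p = csnd p;
  mul_unit_r : forall (p : comp) x, csnd p = unit x -> mul p = cfst p;
  mul_inv_l : forall p : comp,
    cfst p = inv (csnd p) -> mul p = unit (src (csnd p));
  mul_inv_r : forall p : comp,
    csnd p = inv (cfst p) -> mul p = unit (tgt (cfst p)) }.

Section Groupoid.
Context {R : realType}.
Implicit Types (G H : lieGroupoid R).

Definition same_orbit G (x y : obj G) : Prop :=
  exists g : arr G, src g = x /\ tgt g = y.

Lemma same_orbit_refl G : reflexive (fun x y : obj G => `[< same_orbit x y >]).
Proof.
by move=> x; apply/asboolP; exists (unit x); rewrite src_unit tgt_unit.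
Qed.

Lemma same_orbit_sym G : symmetric (fun x y : obj G => `[< same_orbit x y >]).
Proof.
by move=> x y; apply/asboolP/asboolP => -[g [<- <-]];
  exists (inv g); rewrite src_inv tgt_inv.
Qed.

Lemma same_orbit_trans G :
  transitive (fun x y : obj G => `[< same_orbit x y >]).
Proof.
move=> y x z /asboolP [g [sg tg]] /asboolP [h [sh th]].
have e : src h = tgt g by rewrite sh tg.
by apply/asboolP; exists (mul (cpair e)); rewrite src_mul tgt_mul.
Qed.

Definition orbit_equiv G : equiv_rel (obj G) :=
  EquivRel _ (@same_orbit_refl G) (@same_orbit_sym G) (@same_orbit_trans G).

Definition orbit_space G : topologicalType :=
  quotient_topology {eq_quot (orbit_equiv G)}.

Definition orbit_rep G (q : orbit_space G) : obj G :=
  repr (q : {eq_quot (orbit_equiv G)}).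

Definition orbit_class G (x : obj G) : orbit_space G :=
  \pi_({eq_quot (orbit_equiv G)}) x.

Lemma orbit_classP G (x y : obj G) :
  orbit_class x = orbit_class y <-> same_orbit x y.
Proof.
split=> [/eqmodP/asboolP //|xy]; by apply/eqmodP/asboolP.
Qed.

Lemma orbit_repK G (q : orbit_space G) : orbit_class (orbit_rep q) = q.
Proof. exact: (@reprK _ {eq_quot (orbit_equiv G)}). Qed.

Definition isotropy G (x : obj G) : set (arr G) :=
  [set g | src g = x /\ tgt g = x].

(* T_x O_x, as a row space: the orbit O_x carries the manifold structure for
   which t : s^-1(x) -> O_x is a submersion, so T_x O_x is the image under dt
   of T_(1_x) s^-1(x) = ker ds. *)
Definition orbit_tangent G (x : obj G) : 'M[R]_(mdim (obj G)) :=
  <<kermx (mfd (@src R G) (unit x)) *m mfd (@tgt R G) (unit x)>>%MS.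

(* Equality in N_x O = T_x M / T_x O_x of the classes of v and w. *)
Definition normal_eq G (x : obj G) (v w : 'rV[R]_(mdim (obj G))) : Prop :=
  (v - w <= orbit_tangent x)%MS.

(* The identification N_x O ~ (T_x O_x)^perp, on representatives. *)
Definition horizontal G (eta0 : riemMetric (obj G)) (x : obj G)
    (v : 'rV[R]_(mdim (obj G))) : 'rV[R]_(mdim (obj G)) :=
  v *m proj_mx (kermx (eta0 x *m (orbit_tangent x)^T)) (orbit_tangent x).

(* The induced inner product of N_x O, on representatives. *)
Definition normal_inner G (eta0 : riemMetric (obj G)) (x : obj G)
    (v w : 'rV[R]_(mdim (obj G))) : R :=
  inner (eta0 x) (horizontal eta0 x v) (horizontal eta0 x w).

Record groupoidMap H G := GroupoidMap {
  fobj : obj H -> obj G;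
  farr : arr H -> arr G;
  fobj_smooth : smooth_map fobj;
  farr_smooth : smooth_map farr;
  src_farr : forall g, src (farr g) = fobj (src g);
  tgt_farr : forall g, tgt (farr g) = fobj (tgt g);
  farr_unit : forall x, farr (unit x) = unit (fobj x);
  farr_mul : forall (p : comp H) (q : comp G),
    cfst q = farr (cfst p) -> csnd q = farr (csnd p) -> farr (mul p) = mul q }.

Definition orbit_map H G (f : groupoidMap H G) (q : orbit_space H) :
  orbit_space G := orbit_class (fobj f (orbit_rep q)).

Lemma orbit_mapE H G (f : groupoidMap H G) (x : obj H) :
  orbit_map f (orbit_class x) = orbit_class (fobj f x).
Proof.
have /orbit_classP [g [sg tg]] := orbit_repK (orbit_class x).
by apply/orbit_classP; exists (farr f g); rewrite src_farr tgt_farr sg tg.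
Qed.

Definition homeomorphism (S T : topologicalType) (f : S -> T) : Prop :=
  continuous f /\
  exists g : T -> S, [/\ continuous g, cancel f g & cancel g f].

(* f_x : H_x -> G_(f x) is an isomorphism of Lie groups; the isotropy groups
   are embedded submanifolds of the manifolds of arrows. *)
Definition isotropy_iso H G (f : groupoidMap H G) (x : obj H) : Prop :=
  exists k : arr G -> arr H,
    [/\ forall h, isotropy x h -> k (farr f h) = h,
        forall g, isotropy (fobj f x) g ->
          isotropy x (k g) /\ farr f (k g) = g
      & smooth_map_on_subset (isotropy (fobj f x)) k].

(* [d_x f] : N_x O -> N_(f x) O is an isomorphism: injective and surjective. *)
Definition normal_iso H G (f : groupoidMap H G) (x : obj H) : Prop :=
  (forall v w, normal_eq (fobj f x) (v *m mfd (fobj f) x) (w *m mfd (fobj f) x)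
     -> normal_eq x v w) /\
  (forall w, exists v, normal_eq (fobj f x) (v *m mfd (fobj f) x) w).

Definition morita H G (f : groupoidMap H G) : Prop :=
  [/\ homeomorphism (orbit_map f),
      forall x, isotropy_iso f x
    & forall x, normal_iso f x].

(* (g, h) |-> (h^-1, g^-1) *)
Definition swap_triangle G (p : comp G) : comp G :=
  cpair (etrans (src_inv (csnd p))
          (etrans (esym (composableP p)) (esym (tgt_inv (cfst p))))).

(* (g, h) |-> (gh, h^-1) *)
Definition rot_triangle G (p : comp G) : comp G :=
  cpair (etrans (src_mul p) (esym (tgt_inv (csnd p)))).

End Groupoid.

(* eta2 is the groupoid metric: it is S_3-invariant, and transverse to the
   multiplication, i.e. it descends to a metric eta1. The metrics eta1 and eta0
   are the ones that eta2 induces: as mul and src are surjective submersions,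
   they are determined by eta2 through eta1_induced and eta0_induced. *)
Record riemGroupoid (R : realType) := RiemGroupoid {
  groupoid :> lieGroupoid R;
  eta2 : riemMetric (comp groupoid);
  eta2_swap : forall p, isometric_at eta2 eta2 (@swap_triangle R groupoid) p;
  eta2_rot : forall p, isometric_at eta2 eta2 (@rot_triangle R groupoid) p;
  eta1 : riemMetric (arr groupoid);
  eta1_induced : riem_submersion eta2 eta1 (@mul R groupoid);
  eta0 : riemMetric (obj groupoid);
  eta0_induced : riem_submersion eta1 eta0 (@src R groupoid) }.

Definition riem_morita {R : realType} {H G : riemGroupoid R}
    (f : groupoidMap H G) : Prop :=
  morita f /\
  forall x v w,
    normal_inner (eta0 G) (fobj f x) (v *m mfd (fobj f) x) (w *m mfd (fobj f) x)
    = normal_inner (eta0 H) x v w.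

(* c 0, ..., c (2n+1) is a chain from x to y. *)
Definition chain {R : realType} (G : lieGroupoid R) (x y : obj G) (n : nat)
    (c : nat -> obj G) : Prop :=
  [/\ c 0%N = x, c n.*2.+1 = y,
      forall i, (i <= n)%N -> same_orbit (c i.*2) (c i.*2.+1)
    & forall i, (1 <= i <= n)%N ->
        connected_component [set: obj G] (c i.*2.-1) (c i.*2)].

Definition chain_dist {R : realType} (G : riemGroupoid R) (x y : obj G) :
    \bar R :=
  ereal_inf [set l | exists n c, chain x y n c /\
    l = (\sum_(1 <= i < n.+1) riem_dist (eta0 G) (c i.*2.-1) (c i.*2))%E].

(* chain_dist depends only on the orbits of x and y, as c 0 and c (2n+1) can be
   moved freely along their orbits. *)
Definition normal_dist {R : realType} (G : riemGroupoid R)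
    (p q : orbit_space G) : \bar R :=
  chain_dist (orbit_rep p) (orbit_rep q).

(* Main.v *)
Require Import Defs.
From HB Require Import structures.
From mathcomp Require Import all_boot all_order all_algebra.
From mathcomp Require Import all_classical all_reals all_analysis.
From mathcomp Require Import ring lra zify.
Import Order.TTheory GRing.Theory Num.Theory numFieldNormedType.Exports.
Import Defs.

(** A Riemannian Morita map phi from H to G preserves normal distances because
neither the map it induces on orbit spaces nor the inverse of that map
stretches curves to first order. Given a curve c in the objects of one groupoid
and a time t, there is a curve b in the objects of the other one which, for s
near t, meets the orbit corresponding to that of c s, and whose velocity at t
is no longer than that of c ([push_curve], [pull_curve]). The curve b depends
on t, and only its differentiability at t is used: it bounds the change of the
distance from a fixed point to the corresponding orbit between the times t and
s by (|c'(t)| + e) |s - t|. Such bounds at all times t integrate to the length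
of c ([growth_le_integral]). Adding up along paths and chains, neither map
increases d_N ([short_normal_dist]), so both preserve it
([morita_normal_dist]). The theorem composes the isometry of phi' with the
inverse of that of phi.

Forward, b is phi o c, moved along the orbits by arrows close to units so that
its velocity becomes orthogonal to the orbit ([straighten_curve]). The length
of this velocity is the norm of the normal vector which [d phi] assigns to the
class of c'(t), that is the norm of the class of c'(t), at most |c'(t)|.

Backward, the orbit of c t contains some phi y. An arrow from c t to phi y
can carry c to a curve through phi y whose velocity is no longer: lift c'(t)
orthogonally through the source map, and apply the target map. The latter
contracts lengths because it is the source map after the inversion, and the
inversion contracts lengths by the symmetry (g, h) |-> (h^-1, g^-1) of the
metric on composable pairs ([inv_contracts], [tgt_contracts]). It remains to
follow a curve c through phi y by solving phi x = s(h), t(h) = c for (x, h)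
near (y, 1). The derivative of this system is onto because [d_y phi] is
([fibre_surj]), and its solutions v in the x component are the vectors such
that d phi(v) is c'(t) modulo the orbit, so v can be taken orthogonal to the
orbit of y; then |v| is the norm of the class of c'(t) ([fibre_lift]).

The equations are solved along curves, with a prescribed velocity, by a
fixed-point argument which uses a right inverse of the derivative at one point
and strict differentiability there ([strict_diff_solve], [solve_curve]). A
curve differentiable at t is compared with the Riemannian distance through the
straight segments of a chart ([tangent_dist]). *)

Set Implicit Arguments.
Unset Strict Implicit.
Unset Printing Implicit Defensive.

Local Open Scope classical_set_scope.
Local Open Scope ring_scope.

(** * Differentials as matrices *)
Lemma diff_eps {R : numFieldType} {V W : normedModType R} (f : V -> W) x :
  differentiable f x -> forall e, 0 < e ->
  \forall y \near x, `|f y - f x - 'd f x (y - x)| <= e * `|y - x|.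
Proof.
move=> /diff_locally /eqaddoP H e e0; rewrite (near_shift 0 x)/=.
have := H _ e0; apply: filterS => h; rewrite /= !subr0 addrK !fctE.
by rewrite opprD addrA.
Qed.

Lemma eps_diff {R : numFieldType} {V W : normedModType R} (f : V -> W)
    (df : {linear V -> W}) x : continuous df ->
  (forall e, 0 < e ->
     \forall y \near x, `|f y - f x - df (y - x)| <= e * `|y - x|) ->
  is_diff x f df.
Proof.
move=> dfc H.
have E : f \o shift x = cst (f x) + df +o_ 0 id.
  apply/eqaddoP => e e0; have := H _ e0; rewrite (near_shift 0 x)/=.
  by apply: filterS => h; rewrite /= !subr0 addrK !fctE opprD addrA.
have D := diff_unique dfc E.
by constructor => //; apply/diff_locallyP; rewrite D.
Qed.

HB.instance Definition _ (R : realType) m n :=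
  Uniform_isComplete.Build 'M[R]_(m, n) (@mx_complete R m n).

Lemma mx_entry_le {R : realFieldType} m n (A : 'M[R]_(m, n)) i j :
  `|A i j| <= `|A|.
Proof.
by rewrite [leRHS]/Num.Def.normr /= mx_normrE; exact: (le_bigmax _ _ (i, j)).
Qed.

Lemma mx_norm_le {R : realFieldType} m n (A : 'M[R]_(m, n)) (c : R) :
  0 <= c -> (forall i j, `|A i j| <= c) -> `|A| <= c.
Proof.
move=> c0 H; rewrite [leLHS]/Num.Def.normr /= mx_normrE.
by apply: bigmax_le => // -[i j] _; exact: H.
Qed.

Lemma mulmx_norm_le {R : realFieldType} m n p (A : 'M[R]_(m, n))
    (B : 'M[R]_(n, p)) : `|A *m B| <= n%:R * `|A| * `|B|.
Proof.
apply: mx_norm_le => [|i j]; first by rewrite !mulr_ge0.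
rewrite mxE (le_trans (ler_norm_sum _ _ _))//.
rewrite (@le_trans _ _ (\sum_(k < n) `|A| * `|B|))//.
  by apply: ler_sum => k _; rewrite normrM ler_pM ?mx_entry_le.
by rewrite sumr_const card_ord -[leLHS]mulr_natl mulrA.
Qed.

Lemma cvg_mx {R : realFieldType} {T : Type} (F : set_system T) {FF : Filter F}
    m n (M : T -> 'M[R]_(m, n)) (L : 'M[R]_(m, n)) :
  (forall i j, M x i j @[x --> F] --> L i j) -> M x @[x --> F] --> L.
Proof.
move=> H; apply/cvgrPdist_le => e e0.
have : \forall x \near F, forall ij : 'I_m * 'I_n,
    `|L ij.1 ij.2 - M x ij.1 ij.2| <= e.
  by apply: filter_forall => -[i j]; exact: ((cvgrPdist_le _ _).1 (H i j)).
apply: filterS => x Hx; apply: mx_norm_le => [|i j]; first exact: ltW.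
by rewrite !mxE; exact: (Hx (i, j)).
Qed.

Lemma cvg_mxP {R : realFieldType} {T : Type} (F : set_system T) {FF : Filter F}
    m n (M : T -> 'M[R]_(m, n)) (L : 'M[R]_(m, n)) i j :
  M x @[x --> F] --> L -> M x i j @[x --> F] --> L i j.
Proof.
move=> H; apply: (@continuous_cvg _ _ _ _ _ M (fun A : 'M[R]_(m, n) => A i j)).
  exact: coord_continuous.
exact: H.
Qed.

Lemma cvg_mulmx {R : realFieldType} {T : Type} (F : set_system T)
    {FF : Filter F} m n p (M : T -> 'M[R]_(m, n)) (N : T -> 'M[R]_(n, p))
    (A : 'M[R]_(m, n)) (B : 'M[R]_(n, p)) :
  M x @[x --> F] --> A -> N x @[x --> F] --> B ->
  M x *m N x @[x --> F] --> A *m B.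
Proof.
move=> HM HN; apply: cvg_mx => i j; rewrite mxE.
under eq_fun do rewrite mxE.
elim: (index_enum _) => [|k s IH].
  by rewrite big_nil; under eq_fun do rewrite big_nil; exact: cvg_cst.
rewrite big_cons.
rewrite (_ : (fun x => _) = (fun x => M x i k * N x k j
    + \sum_(l <- s) M x i l * N x l j)); last first.
  by apply/funext => x; rewrite big_cons.
by apply: cvgD IH; apply: cvgM; exact: cvg_mxP.
Qed.

Lemma cvg_trmx {R : realFieldType} {T : Type} (F : set_system T)
    {FF : Filter F} m n (M : T -> 'M[R]_(m, n)) (A : 'M[R]_(m, n)) :
  M x @[x --> F] --> A -> (M x)^T @[x --> F] --> A^T.
Proof.
move=> HM; apply: cvg_mx => i j; rewrite mxE; under eq_fun do rewrite mxE.
exact: cvg_mxP.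
Qed.

Lemma mulmxr_continuous {R : realFieldType} m n p (B : 'M[R]_(n, p)) :
  continuous (fun A : 'M[R]_(m, n) => A *m B).
Proof.
move=> A; apply: (@cvg_mulmx _ _ (nbhs A) _ _ _ _ id (fun=> B)).
  exact: cvg_id.
exact: cvg_cst.
Qed.

Lemma smooth_on_diff {R : realType} {V W : normedModType R} (U : set V)
    (f : V -> W) x : smooth_on U f -> U x -> differentiable f x.
Proof. by move=> H Ux; exact: (H [::] x Ux). Qed.

Lemma smooth_on_derive {R : realType} {V W : normedModType R} (U : set V)
    (f : V -> W) v : smooth_on U f -> smooth_on U (fun x => 'D_v f x).
Proof. by move=> H vs x Ux; have := H (rcons vs v) x Ux;
  rewrite foldr_rcons. Qed.

Lemma near_eq_diff {R : numFieldType} {V W : normedModType R} (f g : V -> W) x :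
  (\near x, f x = g x) -> differentiable f x -> is_diff x g ('d f x).
Proof.
move=> fg df; apply: eps_diff => [|e e0]; first exact: diff_continuous.
have := diff_eps df e0; have -> := nbhs_singleton fg.
by apply: filterS2 fg => y ->.
Qed.

Lemma near_norm {R : numFieldType} {V : normedModType R} (x : V) (P : set V) :
  nbhs x P -> exists2 d, 0 < d & forall y, `|y - x| < d -> P y.
Proof.
move=> /(nbhs_normP x)[d d0 H]; exists d => // y yd.
by apply: H; rewrite /ball_/= distrC.
Qed.

HB.lock Definition jac {R : realType} {m n} (f : 'rV[R]_m -> 'rV[R]_n)
  (x : 'rV[R]_m) : 'M[R]_(m, n) := jacobian f x.

Lemma diff_jac {R : realType} m n (f : 'rV[R]_m -> 'rV[R]_n) x v :
  'd f x v = v *m jac f x.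
Proof. by rewrite jac.unlock /jacobian mul_rV_lin1. Qed.

Lemma mulmx_extl {R : realType} m n (A B : 'M[R]_(m, n)) :
  (forall v : 'rV_m, v *m A = v *m B) -> A = B.
Proof. by move=> H; apply/row_matrixP => i; rewrite !rowE. Qed.

Lemma jac_unique {R : realType} m n (f : 'rV[R]_m -> 'rV[R]_n) x J :
  (forall e, 0 < e ->
     \forall y \near x, `|f y - f x - (y - x) *m J| <= e * `|y - x|) ->
  differentiable f x /\ jac f x = J.
Proof.
move=> H; have [Hd HE] : is_diff x f (mulmxr J).
  by apply: eps_diff => //; exact: mulmxr_continuous.
split=> //; apply/row_matrixP => i; rewrite !rowE.
by rewrite -diff_jac HE.
Qed.

Lemma jac_near {R : realType} m n (f g : 'rV[R]_m -> 'rV[R]_n) x :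
  (\near x, f x = g x) -> differentiable f x ->
  differentiable g x /\ jac g x = jac f x.
Proof.
move=> fg df; have [dg E] := near_eq_diff fg df; split; first exact: dg.
apply: mulmx_extl => v; rewrite -(diff_jac g x) -(diff_jac f x).
exact: (congr1 (fun h => h v) E).
Qed.

Lemma jac_comp {R : realType} m n p (f : 'rV[R]_m -> 'rV[R]_n)
    (g : 'rV[R]_n -> 'rV[R]_p) x :
  differentiable f x -> differentiable g (f x) ->
  jac (g \o f) x = jac f x *m jac g (f x).
Proof.
move=> df dg; apply/row_matrixP => i; rewrite !rowE mulmxA.
by rewrite -!diff_jac diff_comp.
Qed.

Lemma jac_id {R : realType} m x : jac (@id 'rV[R]_m) x = 1%:M.
Proof.
apply/row_matrixP => i; rewrite !rowE mulmx1 -diff_jac.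
by have [_ ->] := is_diff_id x.
Qed.

Lemma jac_entry {R : realType} m n (f : 'rV[R]_m -> 'rV[R]_n) x i j :
  differentiable f x -> jac f x i j = 'D_(delta_mx 0 i) f x 0 j.
Proof. by move=> df; rewrite (deriveE _ df) diff_jac -rowE [RHS]mxE. Qed.

(** The entries of the Jacobian matrix are directional derivatives, which are
again smooth. *)
Lemma jac_cvg {R : realType} m n (f : 'rV[R]_m -> 'rV[R]_n) U x :
  nbhs x U -> smooth_on U f -> jac f y @[y --> x] --> jac f x.
Proof.
move=> UN sf; have Ux := nbhs_singleton UN;
  apply: (@cvg_mx _ _ (nbhs x)) => i j.
have E := jac_entry i j (smooth_on_diff sf Ux).
have H : 'D_(delta_mx 0 i) f y 0 j @[y --> x] --> jac f x i j.
  rewrite E.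
  apply: (@cvg_mxP _ _ (nbhs x) _ _ _ (fun y => 'D_(delta_mx 0 i) f y)).
  exact: (differentiable_continuous
    (smooth_on_diff (smooth_on_derive _ sf) Ux)).
apply: cvg_trans H; apply: near_eq_cvg; apply: filterS UN => y Uy /=.
by rewrite jac_entry//; exact: smooth_on_diff sf Uy.
Qed.

(** * Strict differentiability and solving equations *)
(** [strict_diff f x J]: f is strictly differentiable at x with Jacobian J. *)
(** Both points vary, which is what makes the map [T] of [strict_diff_solve] a
contraction; mere differentiability compares with the centre x only. *)
Definition strict_diff {R : realType} {m n} (f : 'rV[R]_m -> 'rV[R]_n)
    (x : 'rV[R]_m) (J : 'M[R]_(m, n)) : Prop :=
  forall e, 0 < e -> exists2 d, 0 < d &
    forall y z, `|y - x| < d -> `|z - x| < d ->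
    `|f y - f z - (y - z) *m J| <= e * `|y - z|.

Lemma ball_convex {R : realType} n (x p q : 'rV[R]_n) (d t : R) :
  `|p - x| < d -> `|q - x| < d -> t \in `[0, 1] -> `|p + t *: (q - p) - x| < d.
Proof.
move=> pd qd; rewrite in_itv/= => /andP[t0 t1].
have -> : p + t *: (q - p) - x = (1 - t) *: (p - x) + t *: (q - x).
  by apply/rowP => i; rewrite !mxE; ring.
rewrite (le_lt_trans (ler_normD _ _))// !normrZ !ger0_norm ?subr_ge0//.
have [->|tn0] := eqVneq t 0; first by rewrite subr0 mul1r mul0r addr0.
have tp : 0 < t by rewrite lt_def tn0.
rewrite (@le_lt_trans _ _ ((1 - t) * d + t * `|q - x|))//.
  by rewrite lerD2r ler_wpM2l ?subr_ge0// ltW.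
by have := qd; rewrite -(ltr_pM2l tp); lra.
Qed.

(** The mean value theorem along the segment from z to y, for each coordinate
of f, bounds the error by the variation of the Jacobian matrix near x. *)
Lemma smooth_on_strict_diff {R : realType} m n (f : 'rV[R]_m -> 'rV[R]_n) U x :
  nbhs x U -> smooth_on U f -> strict_diff f x (jac f x).
Proof.
move=> UN sf e e0.
(* The product of matrices costs a factor m; m.+1 avoids dividing by 0. *)
have e1 : 0 < e / m.+1%:R by rewrite divr_gt0.
have NJ : \forall y \near x, `|jac f x - jac f y| <= e / m.+1%:R.
  exact: ((cvgrPdist_le _ _).1 (jac_cvg UN sf) _ e1).
have [d d0 Hd] := near_norm (filterI UN NJ); exists d => // y z yd zd.
have seg (t : R) : t \in `[0, 1] -> `|z + t *: (y - z) - x| < d.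
  exact: ball_convex.
apply: mx_norm_le => [|i j]; first by rewrite mulr_ge0// ltW.
pose g (t : R) : R := f (z + t *: (y - z)) 0 j.
have aff (t : R) : is_diff t (fun t : R => z + t *: (y - z)) ( *:%R^~ (y - z)).
  by apply: is_diff_eq; rewrite add0r.
have dg (t : R) : t \in `[0, 1] ->
    is_derive t 1 g (((y - z) *m jac f (z + t *: (y - z))) 0 j).
  move=> t01; have Ut : U (z + t *: (y - z)).
    exact: (Hd _ (seg _ t01)).1.
  have df := smooth_on_diff sf Ut.
  have [dgt E] := @is_diff_comp _ _ _ _ _ _ _ _ _ (aff t) (differentiableP df).
  have dgm : derivable (f \o (fun t : R => z + t *: (y - z))) t 1.
    exact: diff_derivable.
  apply: DeriveDef; first by have/derivable_mxP := dgm; apply.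
  have := derive_mx dgm; rewrite deriveE// E /= scale1r diff_jac => ->.
  by rewrite mxE.
(* The intermediate time depends on the entry, which is harmless as all
   Jacobian matrices on the segment are close to the one at x. *)
have [c c01] := @MVT_segment R g
  (fun t => ((y - z) *m jac f (z + t *: (y - z))) 0 j) 0 1 ler01
  (fun t t01 => dg t (subset_itv_oo_cc t01))
  (derivable_within_continuous
    (fun t t01 => @ex_derive _ _ _ _ _ _ _ (dg t t01))).
rewrite subr0 mulr1 /g scale1r scale0r addr0 subrKC => Eg.
have -> : (f y - f z - (y - z) *m jac f x) i j =
          ((y - z) *m (jac f (z + c *: (y - z)) - jac f x)) 0 j.
  rewrite ord1 mulmxBr; move: Eg; move: (_ *m jac f (z + _)) (_ *m jac f x).
  by move=> A B Eg; rewrite !mxE -Eg.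
apply: le_trans (mx_entry_le _ _ _) _; apply: le_trans (mulmx_norm_le _ _) _.
have Hc := (Hd _ (seg _ c01)).2; rewrite distrC in Hc.
apply: (@le_trans _ _ (m%:R * `|y - z| * (e / m.+1%:R))).
  by rewrite ler_wpM2l ?mulr_ge0.
have -> : m%:R * `|y - z| * (e / m.+1%:R) = m%:R / m.+1%:R * (e * `|y - z|).
  by rewrite !mulrA -!mulrA; congr (_ * _); ring.
rewrite ler_piMl//; first by rewrite mulr_ge0// ltW.
by rewrite ler_pdivrMr// mul1r ler_nat.
Qed.

Lemma strict_diff_lipschitz {R : realType} m n (f : 'rV[R]_m -> 'rV[R]_n) x J :
  strict_diff f x J -> exists2 d, 0 < d & forall y, `|y - x| < d ->
    `|f y - f x| <= (1 + m%:R * `|J|) * `|y - x|.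
Proof.
move=> /(_ _ ltr01)[d d0 H]; exists d => // y yd.
have := H y x yd; rewrite subrr normr0 => /(_ d0) {}H.
rewrite -[f y - f x](subrK ((y - x) *m J)) (le_trans (ler_normD _ _))//.
rewrite mulrDl lerD// (le_trans (mulmx_norm_le _ _))//.
by rewrite mulrAC.
Qed.

(** A form of the Lyusternik-Graves theorem: where the derivative J has a right
inverse A, equations F = y are solved by a correction in the image of A, of size
proportional to the defect. The correction is the fixed point of the Newton map
w |-> w - (F (x + w A) - y), whose derivative at w = 0 and x = p is
1 - A J = 0. *)
Lemma strict_diff_solve {R : realType} n m (F : 'rV[R]_n -> 'rV[R]_m) p J
    (A : 'M[R]_(m, n)) : strict_diff F p J -> A *m J = 1%:M ->
  exists2 d, 0 < d & forall x y, `|x - p| < d -> `|y - F p| < d ->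
    exists2 w, F (x + w *m A) = y & `|w| <= 2 * `|F x - y|.
Proof.
move=> sF AJ; have [d0 d0_gt0 lipF] := strict_diff_lipschitz sF.
(* K bounds w |-> w *m A, and L is a Lipschitz constant of F at p. With the
   tolerance 1 / (2 (K + 1)) the map T below contracts by 1/2. *)
pose K := m%:R * `|A|; pose L := 1 + n%:R * `|J|.
have K0 : 0 <= K by rewrite mulr_ge0.
have L0 : 0 <= L by rewrite addr_ge0// mulr_ge0.
have e0 : 0 < (2 * (K + 1))^-1 by rewrite invr_gt0 mulr_gt0// ltr_wpDl.
have [d1 d1_gt0 H] := sF _ e0.
(* If x and y are within d1 / M of p and F p, the ball of corrections of
   norm at most r stays in the d1-ball where the tolerance is valid. *)
pose M := 1 + 2 * K * (L + 1).
have M0 : 1 <= M by rewrite lerDl !mulr_ge0// addr_ge0.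
have M_gt0 : 0 < M by rewrite (lt_le_trans ltr01).
exists (Num.min d0 (d1 / M)); first by rewrite lt_min d0_gt0 divr_gt0.
move=> x y; rewrite !lt_min => /andP[xd0 xd1] /andP[_ yd1].
pose r := 2 * `|F x - y|.
have rL : r <= 2 * (L + 1) * (d1 / M).
  rewrite /r -mulrA ler_wpM2l// -(subrK (F p) (F x)) -addrA.
  rewrite (le_trans (ler_normD _ _))// mulrDl mul1r lerD//.
    by rewrite (le_trans (lipF _ xd0))// ler_wpM2l// ltW.
  by rewrite distrC ltW.
pose U : set 'rV[R]_m := [set w | `|w| <= r].
pose T (w : 'rV[R]_m) := w - (F (x + w *m A) - y).
have near_p w : U w -> `|x + w *m A - p| < d1.
  move=> Uw; rewrite addrAC (le_lt_trans (ler_normD _ _))//.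
  have : `|w *m A| <= K * r.
    by rewrite (le_trans (mulmx_norm_le _ _))// mulrAC ler_wpM2l.
  move=> Hw; rewrite (lt_le_trans (ltr_leD xd1 Hw))//.
  rewrite (le_trans (lerD (lexx _) (ler_wpM2l K0 rL)))//.
  rewrite [leRHS](_ : d1 = M * (d1 / M)); last first.
    by rewrite mulrCA divff ?mulr1// gt_eqF.
  by move: (d1 / M) => q; rewrite le_eqVlt /M; apply/orP; left; apply/eqP; ring.
have ctr w w' : U w -> U w' -> `|T w - T w'| <= 2^-1 * `|w - w'|.
  move=> Uw Uw'.
  have D : x + w *m A - (x + w' *m A) = (w - w') *m A.
    by rewrite mulmxBl; apply/rowP => i; rewrite !mxE; ring.
  have -> : T w - T w' = - (F (x + w *m A) - F (x + w' *m A)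
      - (x + w *m A - (x + w' *m A)) *m J).
    rewrite D -mulmxA AJ mulmx1 /T.
    by apply/rowP => i; rewrite !mxE; ring.
  rewrite normrN (le_trans (H _ _ (near_p _ Uw) (near_p _ Uw')))//.
  rewrite D invfM -mulrA ler_wpM2l// ler_pdivrMl ?ltr_wpDl//.
  rewrite (le_trans (mulmx_norm_le _ _))// mulrAC ler_wpM2r// /K lerDl//.
(* T moves the centre of its ball by half the radius, so that the contraction
   maps the ball to itself. *)
have T0 : `|T 0| = r / 2.
  by rewrite /T mul0mx addr0 sub0r normrN /r mulrAC divff ?mul1r.
have r0 : 0 <= r by rewrite mulr_ge0.
have U0 : U 0 by rewrite /U /= normr0.
have TU : {homo T : w / U w >-> U w}.
  move=> w Uw; rewrite /U /= -(subrK (T 0) (T w)) (le_trans (ler_normD _ _))//.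
  rewrite T0 (le_trans (lerD (ctr _ _ Uw U0) (lexx _)))// subr0.
  by have : `|w| <= r := Uw; lra.
have Tctr : is_contraction (mkfun_fun TU).
  have h0 : (0 : R) <= 2^-1 by [].
  exists (NngNum h0); split=> /=; first by rewrite invf_lt1// ltr1n.
  by move=> [w w'] /= [Uw Uw']; exact: ctr.
have clU : closed U.
  rewrite (_ : U = closed_ball_ Num.norm 0 r); first exact: closed_closed_ball_.
  by apply/seteqP; split=> w; rewrite /U /closed_ball_ /= sub0r normrN.
have [w Uw E] := banach_fixed_point Tctr clU (ex_intro _ _ U0).
exists w => //; apply/eqP; rewrite -subr_eq0; apply/eqP.
by move: E; rewrite /= /T => /esym/eqP;
  rewrite subr_eq addrC -subr_eq subrr eq_sym => /eqP.
Qed.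

Lemma row_mx_norm_le {R : realFieldType} m n1 n2 (A : 'M[R]_(m, n1))
    (B : 'M[R]_(m, n2)) c : `|A| <= c -> `|B| <= c -> `|row_mx A B| <= c.
Proof.
move=> Ac Bc; apply: mx_norm_le => [|i j]; first exact: le_trans Ac.
rewrite mxE; case: fintype.split => k.
  exact: le_trans (mx_entry_le _ _ _) Ac.
exact: le_trans (mx_entry_le _ _ _) Bc.
Qed.

Lemma lsubmx_norm_le {R : realFieldType} m n1 n2 (A : 'M[R]_(m, n1 + n2)) :
  `|lsubmx A| <= `|A|.
Proof. by apply: mx_norm_le => // i j; rewrite mxE mx_entry_le. Qed.

Lemma rsubmx_norm_le {R : realFieldType} m n1 n2 (A : 'M[R]_(m, n1 + n2)) :
  `|rsubmx A| <= `|A|.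
Proof. by apply: mx_norm_le => // i j; rewrite mxE mx_entry_le. Qed.

Lemma jac_eps {R : realType} m n (f : 'rV[R]_m -> 'rV[R]_n) x :
  differentiable f x -> forall e, 0 < e ->
  \forall y \near x, `|f y - f x - (y - x) *m jac f x| <= e * `|y - x|.
Proof.
move=> df e e0; have := diff_eps df e0; apply: filterS => y.
by rewrite diff_jac.
Qed.

Lemma jac_row_mx {R : realType} m n1 n2 (f : 'rV[R]_m -> 'rV[R]_n1)
    (g : 'rV[R]_m -> 'rV[R]_n2) x :
  differentiable f x -> differentiable g x ->
  differentiable (fun y => row_mx (f y) (g y)) x /\
  jac (fun y => row_mx (f y) (g y)) x = row_mx (jac f x) (jac g x).
Proof.
move=> df dg; apply: jac_unique => e e0.
apply: filterS2 (jac_eps df e0) (jac_eps dg e0) => y Hf Hg.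
rewrite mul_mx_row opp_row_mx add_row_mx opp_row_mx add_row_mx.
exact: row_mx_norm_le.
Qed.

(** If i has an injective derivative at f x, then f is as differentiable as
i \o f. The left inverse B recovers f y - f x from i (f y) - i (f x) up to an
error in o(f y - f x); continuity of f makes this error small enough to absorb,
so f is Lipschitz at x, and then the error is o(y - x). *)
Lemma diff_immersion {R : realType} k n m (f : 'rV[R]_k -> 'rV[R]_n)
    (i : 'rV[R]_n -> 'rV[R]_m) x (B : 'M[R]_(m, n)) :
  {for x, continuous f} -> differentiable i (f x) ->
  differentiable (i \o f) x -> jac i (f x) *m B = 1%:M ->
  differentiable f x.
Proof.
move=> fc di dif JB.
set J := jac i (f x) in JB; set D := jac (i \o f) x.
suff H e : 0 < e ->
    \forall y \near x, `|f y - f x - (y - x) *m (D *m B)| <= e * `|y - x|.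
  by have [] := jac_unique H.
move=> e0.
pose b := m%:R * `|B| + 1.
have b0 : 0 < b by rewrite ltr_wpDl// mulr_ge0.
have mulB (v : 'rV[R]_m) : `|v *m B| <= b * `|v|.
  rewrite (le_trans (mulmx_norm_le _ _))// mulrAC ler_wpM2r//.
  by rewrite lerDl.
have split_f y : f y - f x = (i (f y) - i (f x)) *m B
    - (i (f y) - i (f x) - (f y - f x) *m J) *m B.
  by rewrite -mulmxBl subKr -mulmxA JB mulmx1.
pose L := 1 + k%:R * `|D|.
have L0 : 0 < L by rewrite ltr_pwDl// mulr_ge0.
have rem (c : R) : 0 < c -> \forall y \near x,
    `|i (f y) - i (f x) - (f y - f x) *m J| <= c * `|f y - f x|.
  by move=> c0; exact: (fc _ (jac_eps di c0)).
have lip : \forall y \near x, `|f y - f x| <= 2 * b * L * `|y - x|.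
  have h0 : 0 < (2 * b)^-1 by rewrite invr_gt0 mulr_gt0.
  apply: filterS2 (rem _ h0) (jac_eps dif ltr01) => y Hr Hd.
  have Hi : `|i (f y) - i (f x)| <= L * `|y - x|.
    rewrite -[i (f y) - i (f x)](subrK ((y - x) *m D)).
    rewrite (le_trans (ler_normD _ _))// mulrDl lerD//.
    by rewrite (le_trans (mulmx_norm_le _ _))// mulrAC.
  have : `|f y - f x| <= b * (L * `|y - x|) + 2^-1 * `|f y - f x|.
    rewrite {1}split_f (le_trans (ler_normB _ _))// lerD//.
      by rewrite (le_trans (mulB _))// ler_wpM2l// ltW.
    rewrite (le_trans (mulB _))//.
    rewrite (le_trans (ler_wpM2l (ltW b0) Hr))// mulrA.
    by have -> : b * (2 * b)^-1 = 2^-1 by field; exact: lt0r_neq0.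
  by rewrite mulrA => ?; rewrite -!mulrA; lra.
pose c := e / (2 * b).
have c0 : 0 < c by rewrite divr_gt0// mulr_gt0.
pose c' := c / (2 * b * L).
have c'0 : 0 < c' by rewrite divr_gt0// !mulr_gt0.
apply: filterS3 lip (rem _ c'0) (jac_eps dif c0) => y Hl Hr Hd.
have -> : f y - f x - (y - x) *m (D *m B) =
    (i (f y) - i (f x) - (y - x) *m D) *m B
    - (i (f y) - i (f x) - (f y - f x) *m J) *m B.
  have cancel4 (u v w : 'rV[R]_m) : u - v - (u - w) = w - v.
    by rewrite opprB addrC addrA subrK.
  by rewrite -mulmxBl cancel4 [RHS]mulmxBl -[in RHS]mulmxA JB mulmx1 mulmxA.
have -> : e * `|y - x| = b * (c * `|y - x|) + b * (c * `|y - x|).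
  rewrite /c; field; exact: lt0r_neq0.
rewrite (le_trans (ler_normB _ _))// lerD// (le_trans (mulB _))//.
  by rewrite ler_wpM2l// ltW.
rewrite ler_wpM2l ?(ltW b0)// (le_trans Hr)//.
rewrite (le_trans (ler_wpM2l (ltW c'0) Hl))// mulrA /c' divfK// gt_eqF//.
by rewrite !mulr_gt0.
Qed.

(** * Maps of manifolds in charts *)
HB.lock Definition dmf {R : realType} {M N : manifold R} (f : M -> N) (x : M) :
  'M[R]_(mdim M, mdim N) := mfd f x.

Section Charts.
Context {R : realType}.
Implicit Types M N P : manifold R.

Section OneChart.
Context {T : topologicalType} {n : nat} (c : chart R T n).

Lemma chartK x : cdom c x -> cinv c (cmap c x) = x.
Proof. by move=> cx; apply: cmapK; exact: mem_set. Qed.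

Lemma chart_img x : cdom c x -> (cmap c @` cdom c) (cmap c x).
Proof. by move=> cx; exists x. Qed.

Lemma chart_invK p : (cmap c @` cdom c) p -> cmap c (cinv c p) = p.
Proof. by move=> [x cx <-]; rewrite chartK. Qed.

Lemma chart_inv_dom p : (cmap c @` cdom c) p -> cdom c (cinv c p).
Proof. by move=> [x cx <-]; rewrite chartK. Qed.

Lemma chart_nbhs x : cdom c x -> nbhs x (cdom c).
Proof. by move=> cx; apply: open_nbhs_nbhs; split=> //; exact: cdom_open. Qed.

Lemma chart_img_nbhs p : (cmap c @` cdom c) p -> nbhs p (cmap c @` cdom c).
Proof. by move=> cx; apply: open_nbhs_nbhs; split=> //; exact: cimg_open. Qed.

Lemma chart_pullback x (A : set T) : cdom c x -> nbhs x A ->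
  \forall p \near cmap c x, [/\ (cmap c @` cdom c) p & A (cinv c p)].
Proof.
move=> cx xA; apply: filterS2 (chart_img_nbhs (chart_img cx)) _.
  by move=> p cp Ap; split; [exact: cp|exact: Ap].
by apply: (cinv_continuous (chart_img cx)); rewrite chartK.
Qed.

End OneChart.

Lemma mchart_dom M (x : M) : cdom (mchart x) x.
Proof. exact: mem_chart_at. Qed.

Lemma mchartK M (x : M) : cinv (mchart x) (cmap (mchart x) x) = x.
Proof. by rewrite chartK//; exact: mchart_dom. Qed.

Hint Resolve mchart_dom : core.

(** The charts are the distinguished ones at x and at f x, in which tangent
vectors at these points are written. *)
Definition local_expr M N (f : M -> N) (x : M) :
    'rV[R]_(mdim M) -> 'rV[R]_(mdim N) :=
  cmap (mchart (f x)) \o f \o cinv (mchart x).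

Lemma dmfE M N (f : M -> N) x :
  dmf f x = jac (local_expr f x) (cmap (mchart x) x).
Proof. by rewrite dmf.unlock jac.unlock. Qed.

(** The expression in charts means nothing where f leaves the chart at f x;
continuity keeps it inside near x. *)
Definition mdiff M N (f : M -> N) (x : M) : Prop :=
  {for x, continuous f} /\
  differentiable (local_expr f x) (cmap (mchart x) x).

Lemma local_expr_center M N (f : M -> N) x :
  local_expr f x (cmap (mchart x) x) = cmap (mchart (f x)) (f x).
Proof. by rewrite /local_expr /= mchartK. Qed.

Lemma local_expr_near M N (f : M -> N) x : {for x, continuous f} ->
  \forall p \near cmap (mchart x) x,
    [/\ (cmap (mchart x) @` cdom (mchart x)) p,
        cdom (mchart (f x)) (f (cinv (mchart x) p)) &
        cinv (mchart (f x)) (local_expr f x p) = f (cinv (mchart x) p)].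
Proof.
move=> fc; have :=
  chart_pullback (mchart_dom x) (fc _ (chart_nbhs (mchart_dom (f x)))).
by apply: filterS => p [? fp]; split=> //; rewrite /local_expr /= chartK.
Qed.

Lemma local_expr_continuous M N (f : M -> N) x : {for x, continuous f} ->
  {for cmap (mchart x) x, continuous (local_expr f x)}.
Proof.
move=> fc A; rewrite local_expr_center => HA.
have := chart_pullback (mchart_dom x)
  (fc _ (cmap_continuous (mchart_dom (f x)) HA)).
by apply: filterS => p [].
Qed.

Lemma mdiff_comp M N P (f : M -> N) (g : N -> P) x :
  mdiff f x -> mdiff g (f x) ->
  mdiff (g \o f) x /\ dmf (g \o f) x = dmf f x *m dmf g (f x).
Proof.
move=> [fc fd] [gc gd].
have gd' : differentiable (local_expr g (f x))
  (local_expr f x (cmap (mchart x) x)).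
  by rewrite local_expr_center.
have E : \forall p \near cmap (mchart x) x,
    (local_expr g (f x) \o local_expr f x) p = local_expr (g \o f) x p.
  apply: filterS (local_expr_near fc) => p [_ _ H].
  by rewrite /= {1}/local_expr /= H.
have [d J] := jac_near E (differentiable_comp fd gd').
split; first by split=> //; exact: (continuous_comp fc gc).
by rewrite !dmfE J jac_comp// local_expr_center.
Qed.

Lemma mdiff_id M (x : M) : mdiff id x /\ dmf (@id M) x = 1%:M.
Proof.
have E : \forall p \near cmap (mchart x) x, id p = local_expr id x p.
  have := chart_img_nbhs (chart_img (mchart_dom x)).
  by apply: filterS => p Hp; rewrite /local_expr /= chart_invK.
have di : differentiable (@id 'rV[R]_(mdim M)) (cmap (mchart x) x) by [].
have [d J] := jac_near E di.
by split; [split=> //; exact: cvg_id|rewrite dmfE J jac_id].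
Qed.

Lemma smooth_map_continuous M N (f : M -> N) x :
  smooth_map f -> {for x, continuous f}.
Proof. by move=> [+ _]; apply. Qed.

Lemma smooth_local_expr M N (f : M -> N) x : smooth_map f ->
  exists2 U, nbhs (cmap (mchart x) x) U & smooth_on U (local_expr f x).
Proof.
move=> sf; have [fc fs] := sf.
exists (cmap (mchart x) @`
  (setT `&` cdom (mchart x) `&` f @^-1` cdom (mchart (f x)))).
  apply: filterS (local_expr_near (fc x I)) => p [Hp Hf _].
  by exists (cinv (mchart x) p);
    [split=> //; split=> //; exact: chart_inv_dom|exact: chart_invK].
exact: fs.
Qed.

Lemma smooth_mdiff M N (f : M -> N) x : smooth_map f -> mdiff f x.
Proof.
move=> sf; split; first exact: smooth_map_continuous.
have [U xU sU] := smooth_local_expr x sf.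
exact: smooth_on_diff sU (nbhs_singleton xU).
Qed.

Lemma smooth_strict_diff M N (f : M -> N) x : smooth_map f ->
  strict_diff (local_expr f x) (cmap (mchart x) x) (dmf f x).
Proof.
move=> sf; have [U xU sU] := smooth_local_expr x sf.
by rewrite dmfE; exact: smooth_on_strict_diff sU.
Qed.

End Charts.
#[local] Hint Resolve mchart_dom : core.

(** * Speed and length of curves *)
Section Curves.
Context {R : realType}.
Implicit Types M : manifold R.

Lemma inner_scale n (A : 'M[R]_n) (h : R) v :
  inner A (h *: v) (h *: v) = h ^+ 2 * inner A v v.
Proof.
by rewrite /inner -!scalemxAl linearZ/= -scalemxAr !mxE mulrA.
Qed.

Lemma cvg_inner {T : Type} (F : set_system T) {FF : Filter F} n
    (A : T -> 'M[R]_n) (v w : T -> 'rV[R]_n) (A0 : 'M[R]_n) (v0 w0 : 'rV[R]_n) :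
  A x @[x --> F] --> A0 -> v x @[x --> F] --> v0 -> w x @[x --> F] --> w0 ->
  inner (A x) (v x) (w x) @[x --> F] --> inner A0 v0 w0.
Proof.
move=> HA Hv Hw; apply: (@cvg_mxP _ _ F _ _ _ (fun x => v x *m A x *m (w x)^T)).
by apply: cvg_mulmx; [exact: cvg_mulmx|exact: cvg_trmx].
Qed.

(** The metric is given at each point y in the chart at y; here it is
transported to the single chart at x, where it depends smoothly on p. *)
Definition gram M (g : riemMetric M) (x : M) (p : 'rV[R]_(mdim M)) :
    'M[R]_(mdim M) :=
  let y := cinv (mchart x) p in
  let J := jac (cmap (mchart y) \o cinv (mchart x)) p in
  J *m g y *m J^T.

Lemma gram_smooth M (g : riemMetric M) (x : M) :
  smooth_on (cmap (mchart x) @` cdom (mchart x)) (gram g x).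
Proof.
have -> : gram g x = (fun p => let y := cinv (mchart x) p in
                let J := jacobian (cmap (mchart y) \o cinv (mchart x)) p in
                J *m metric g y *m J^T).
  by apply/funext => p; rewrite /gram jac.unlock.
exact: metric_smooth.
Qed.

Lemma gram_center M (g : riemMetric M) (x : M) :
  gram g x (cmap (mchart x) x) = g x.
Proof.
rewrite /gram /= mchartK.
have := (mdiff_id x).2; rewrite dmfE => E.
have -> : jac (cmap (mchart x) \o cinv (mchart x)) (cmap (mchart x) x) = 1%:M.
  by rewrite -E.
by rewrite mul1mx trmx1 mulmx1.
Qed.

Definition speed M (g : riemMetric M) (gamma : R -> M) (t : R) : R :=
  Num.sqrt (inner (g (gamma t)) (velocity gamma t) (velocity gamma t)).

Lemma transition_diff M (x y : M) p :
  (cmap (mchart x) @` cdom (mchart x)) p ->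
  cdom (mchart y) (cinv (mchart x) p) ->
  differentiable (cmap (mchart y) \o cinv (mchart x)) p.
Proof.
move=> Hp Hy.
apply: (@smooth_on_diff R 'rV[R]_(mdim M) 'rV[R]_(mdim M) _ _ p
  (@chart_compat _ _ (mstruct M) x y)).
exists (cinv (mchart x) p); last exact: chart_invK.
by split=> //; exact: chart_inv_dom.
Qed.

Lemma velocity_chart M (x : M) (gamma : R -> M) t :
  {for t, continuous gamma} -> cdom (mchart x) (gamma t) ->
  differentiable (cmap (mchart x) \o gamma) t ->
  velocity gamma t = derive1 (cmap (mchart x) \o gamma) t *m
    jac (cmap (mchart (gamma t)) \o cinv (mchart x))
      (cmap (mchart x) (gamma t)).
Proof.
move=> gc gx gd; pose T := cmap (mchart (gamma t)) \o cinv (mchart x).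
have dT : differentiable T ((cmap (mchart x) \o gamma) t).
  by apply: transition_diff; [exact: chart_img|rewrite /= chartK].
have E : \forall s \near t, (T \o (cmap (mchart x) \o gamma)) s =
    (cmap (mchart (gamma t)) \o gamma) s.
  have : \forall s \near t, cdom (mchart x) (gamma s).
    exact: (gc _ (chart_nbhs gx)).
  by apply: filterS => s Hs; rewrite /T /= chartK.
have [d J] := near_eq_diff E (differentiable_comp gd dT).
have -> : velocity gamma t = 'd (T \o (cmap (mchart x) \o gamma)) t 1.
  by rewrite -J; exact: derive1E' d.
by rewrite (diff_comp gd dT) /= diff_jac -(derive1E' gd).
Qed.

(** The speed can be computed in a fixed chart along a piece of the curve,
whereas [velocity] changes chart with the time. *)
Lemma speed_chart M (g : riemMetric M) (x : M) (gamma : R -> M) t :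
  {for t, continuous gamma} -> cdom (mchart x) (gamma t) ->
  differentiable (cmap (mchart x) \o gamma) t ->
  let v := derive1 (cmap (mchart x) \o gamma) t in
  speed g gamma t = Num.sqrt (inner (gram g x (cmap (mchart x) (gamma t))) v v).
Proof.
move=> gc gx gd v; rewrite /speed (velocity_chart gc gx gd) -/v.
by rewrite /inner /gram chartK// trmx_mul !mulmxA.
Qed.

Lemma gram_cvg M (g : riemMetric M) (x : M) p :
  (cmap (mchart x) @` cdom (mchart x)) p ->
  gram g x q @[q --> p] --> gram g x p.
Proof.
by move=> Hp;
  exact: (differentiable_continuous (smooth_on_diff (@gram_smooth _ g x) Hp)).
Qed.

Lemma speed_continuous M (g : riemMetric M) U (gamma : R -> M) t :
  open U -> smooth_curve_on U gamma -> U t ->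
  {for t, continuous (speed g gamma)}.
Proof.
move=> oU [gc gs] Ut; pose x := gamma t; pose c := cmap (mchart x) \o gamma.
have near_t : \forall s \near t, (U `&` gamma @^-1` cdom (mchart x)) s.
  apply: filterI; first exact: open_nbhs_nbhs.
  exact: (gc _ Ut _ (chart_nbhs (mchart_dom x))).
have dc s : (U `&` gamma @^-1` cdom (mchart x)) s ->
  differentiable (c : R -> _) s.
  by move=> Hs; exact: (smooth_on_diff (gs x) Hs).
have gsR : @smooth_on R R 'rV[R]_(mdim M) (U `&` gamma @^-1` cdom (mchart x)) c.
  exact: gs.
have dc' : {for t, continuous (derive1 c)}.
  have -> : derive1 c = (fun s => 'D_1 c s).
    by apply/funext => s; rewrite derive1E.
  apply: differentiable_continuous.
  have H := smooth_on_derive (1 : R) gsR.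
  have H' := smooth_on_diff H (nbhs_singleton near_t).
  exact: H'.
have E : \forall s \near t,
  Num.sqrt (inner (gram g x (c s)) (derive1 c s) (derive1 c s))
    = speed g gamma s.
  apply: filterS near_t => s Hs; rewrite (@speed_chart _ _ x)//.
  - exact: gc Hs.1.
  - exact: Hs.2.
  - exact: dc.
have Et : Num.sqrt (inner (gram g x (c t)) (derive1 c t) (derive1 c t))
    = speed g gamma t := nbhs_singleton E.
suff : speed g gamma s @[s --> t] -->
    Num.sqrt (inner (gram g x (c t)) (derive1 c t) (derive1 c t)).
  by rewrite Et.
apply: cvg_trans; first exact: (near_eq_cvg E).
apply: (@continuous_cvg _ _ _ _ _ _ Num.sqrt); first exact: sqrt_continuous.
apply: cvg_inner => //.
have ct : (cmap (mchart x) @` cdom (mchart x)) (c t).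
  by apply: chart_img; exact: (mchart_dom x).
apply: (@cvg_comp _ _ _ c (gram g x) (nbhs t) (nbhs (c t)));
  last exact: gram_cvg.
exact: (differentiable_continuous (dc _ (nbhs_singleton near_t))).
Qed.

Let mu : measure _ _ := @lebesgue_measure R.

Lemma itv_integrable (f : R -> R) (a b : R) :
  (forall t, t \in `[a, b] -> {for t, continuous f}) ->
  mu.-integrable `[a, b] (EFin \o f).
Proof.
move=> fc; apply: continuous_compact_integrable; first exact: segment_compact.
by apply: continuous_in_subspaceT => t; rewrite inE /=; exact: fc.
Qed.

Lemma Rintegral_segment_le (f : R -> R) (c : R) :
  (forall t, t \in `[0, 1] -> {for t, continuous f}) ->
  (forall t, t \in `[0, 1] -> f t <= c) ->
  \int[mu]_(t in `[0%R, 1%R]) f t <= c.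
Proof.
move=> fc fle.
have H : \int[mu]_(t in `[0%R, 1%R]) f t <= \int[mu]_(t in `[0%R, 1%R]) c.
  apply: le_Rintegral => //.
  - exact: itv_integrable.
  - by apply: itv_integrable => t _; exact: cvg_cst.
apply: (le_trans H);
  rewrite Rintegral_cst//= /mu lebesgue_measure_itv /= lte_fin ltr01.
by rewrite -EFinB /= subr0 mulr1.
Qed.

Lemma primitive_growth (f : R -> R) (a b c : R) :
  0 <= a -> a <= b -> b <= 1 ->
  (forall t, t \in `[0, 1] -> {for t, continuous f}) ->
  (forall t, t \in `[a, b] -> c <= f t) ->
  \int[mu]_(t in `[0%R, a]) f t + c * (b - a) <= \int[mu]_(t in `[0%R, b]) f t.
Proof.
move=> a0 ab b1 fc fge.
have fi : mu.-integrable `[0, b] (EFin \o f).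
  apply: itv_integrable => t; rewrite in_itv/= => /andP[t0 tb]; apply: fc.
  by rewrite in_itv/= t0 (le_trans tb).
rewrite -lerBrDl Rintegral_itvB ?bnd_simp//.
have <- : \int[mu]_(t in `]a, b]) c = c * (b - a).
  rewrite Rintegral_cst//= /mu lebesgue_measure_itv /= lte_fin.
  move: ab; rewrite le_eqVlt => /predU1P[->|->]; first by rewrite ltxx subrr.
  by rewrite -EFinB.
apply: le_Rintegral => //.
- apply: (@integrableS _ _ _ mu `[a, b]) => //; first exact: subset_itv_oc_cc.
  by apply: itv_integrable => t _; exact: cvg_cst.
- apply: integrableS fi => //; apply: subset_itvScc; rewrite bnd_simp//.
- by move=> t /= tab; apply: fge; exact: subset_itv_oc_cc tab.
Qed.

(** A real induction. The times up to which F has grown by at most the integral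
of f plus e t form a set containing 0. Its supremum T belongs to it by the
estimate to the left of T, and equals 1 by the estimate to the right. *)
Lemma growth_le_integral (F : R -> \bar R) (f : R -> R) :
  (forall t : R, t \in `[0, 1] -> {for t, continuous f}) ->
  (forall t : R, t \in `[0, 1] -> forall e : R, 0 < e -> \forall s \near t,
     (t <= s -> (F s <= F t + ((f t + e) * (s - t))%:E)%E) /\
     (s <= t -> (F t <= F s + ((f t + e) * (t - s))%:E)%E)) ->
  (F 1%R <= F 0%R + (\int[mu]_(t in `[0%R, 1%R]) f t)%:E)%E.
Proof.
move=> fc Floc; apply/lee_addgt0Pr => e e0.
pose I t := \int[mu]_(x in `[0%R, t]) f x.
rewrite -addeA -EFinD -[\int[mu]_(_ in _) _]/(I 1).
(* Half of e pays for the variation of f near T, half for the local estimate. *)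
have e2 : 0 < e / 2 by rewrite divr_gt0.
pose A := [set t : R | t \in `[0, 1] /\ (F t <= F 0%R + (I t + e * t)%:E)%E].
have step r t c d : (F r <= F 0%R + c%:E)%E -> (F t <= F r + d%:E)%E ->
    (F t <= F 0%R + (c + d)%:E)%E.
  by move=> H1 H2; rewrite (le_trans H2)// EFinD addeA leeD2r.
have A0 : A 0.
  split; first by rewrite in_itv/= lexx ler01.
  by rewrite /I set_itv1 Rintegral_set1 mulr0 addr0 adde0.
have supA : has_sup A.
  by split; [exists 0|exists 1 => t [/[!in_itv]/= /andP[]]].
pose T := sup A.
have T0 : 0 <= T by apply: ub_le_sup => //; exact: supA.2.
have T1 : T <= 1.
  by apply: ge_sup; [exact: supA.1|move=> t [/[!in_itv]/= /andP[]]].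
have T01 : T \in `[0, 1] by rewrite in_itv/= T0.
have fT : \forall s \near T, f T - e / 2 <= f s.
  have H : \forall s \near T, `|f T - f s| <= e / 2.
    exact: ((cvgrPdist_le _ _).1 (fc _ T01) _ e2).
  by apply: filterS H => s; rewrite ler_distl => /andP[]; lra.
have [d d0 Hd] := near_norm (filterI fT (Floc _ T01 _ e2)).
have bound a b : 0 <= a -> a <= b -> b <= 1 -> `|a - T| < d -> `|b - T| < d ->
    I a + e * a + (f T + e / 2) * (b - a) <= I b + e * b.
  move=> a0 ab b1 aT bT.
  have : I a + (f T - e / 2) * (b - a) <= I b.
    apply: primitive_growth => // t; rewrite in_itv/= => /andP[ta tb].
    apply: (Hd t _).1; move: aT bT; rewrite !ltr_norml => /andP[? ?] /andP[? ?].
    by apply/andP; split; lra.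
  by rewrite !mulrBr !mulrDl !mulNr; lra.
have AT : A T.
  split=> //.
  have [s As Ts] := sup_adherent d0 supA.
  have sT : s <= T by apply: ub_le_sup => //; exact: supA.2.
  have [/[!in_itv]/= /andP[s0 s1] Fs] := As.
  have sTd : `|s - T| < d by rewrite ler0_norm ?subr_le0// opprB
    ltrBlDr -ltrBlDl.
  have [_ [_ /(_ sT) H]] := Hd _ sTd.
  apply: (le_trans (step _ _ _ _ Fs H)); rewrite leeD2l// lee_fin.
  by apply: bound => //; rewrite subrr normr0.
suff T_eq1 : T = 1 by have [_] := AT; rewrite T_eq1 mulr1.
apply/eqP; rewrite eq_le T1 /= leNgt; apply/negP => Tlt.
pose s := Num.min 1 (T + d / 2).
have sT : T < s by rewrite lt_min Tlt ltrDl divr_gt0.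
have s1 : s <= 1 by rewrite ge_min lexx.
have sTd : `|s - T| < d.
  rewrite gtr0_norm ?subr_gt0// ltrBlDl (@le_lt_trans _ _ (T + d / 2))//.
    by rewrite ge_min lexx orbT.
  by rewrite ltrD2l; lra.
have [_ [/(_ (ltW sT)) H _]] := Hd _ sTd.
have : A s.
  split; first by rewrite in_itv/= s1 (le_trans T0)// ltW.
  apply: (le_trans (step _ _ _ _ AT.2 H)); rewrite leeD2l// lee_fin.
  by apply: bound => //; [exact: ltW|rewrite subrr normr0].
move=> /(ub_le_sup supA.2); rewrite leNgt -/T sT.
by [].
Qed.

(** The iterated derivatives of t |-> T (a + t b) in real directions are those
of T in multiples of b. *)
Lemma smooth_on_affine m n (W : set 'rV[R]_m) (T : 'rV[R]_m -> 'rV[R]_n) a b :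
  (forall p, W p -> nbhs p W) -> smooth_on W T ->
  @smooth_on R R 'rV[R]_n [set t | W (a + t *: b)] (fun t => T (a + t *: b)).
Proof.
move=> oW sT; pose aff (t : R) : 'rV[R]_m := a + t *: b.
have daff (t : R) : is_diff t aff ( *:%R^~ b).
  by apply: is_diff_eq; rewrite add0r.
have near_t t : W (aff t) -> \forall s \near t, W (aff s).
  by move=> Wt;
    exact: (differentiable_continuous (ex_diff (is_diff_def := daff t))
    (oW _ Wt)).
pose D vs := foldr (fun v g => 'D_v g) T [seq v *: b | v <- vs].
have dD vs t : W (aff t) ->
  is_diff t (D vs \o aff) ('d (D vs) (aff t) \o ( *:%R^~ b)).
  by move=> Wt; apply: is_diff_comp; apply: differentiableP; exact: sT.
have E vs t : W (aff t) ->
    foldr (fun v g => 'D_v g) (fun t => T (aff t)) vs t = D vs (aff t).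
  elim: vs t => [//|v vs IH] t Wt /=.
  have E1 : \forall s \near t,
    foldr (fun v g => 'D_v g) (fun t => T (aff t)) vs s
      = (D vs \o aff) s.
    by apply: filterS (near_t _ Wt) => s Ws; exact: IH.
  have [d1 d2] := dD vs t Wt.
  rewrite (near_eq_derive v E1) (deriveE v d1) d2 /=.
  by rewrite -(deriveE (v *: b) (sT [seq v *: b | v <- vs] _ Wt)).
move=> vs t Wt.
have E1 : \forall s \near t, (D vs \o aff) s
    = foldr (fun v g => 'D_v g) (fun t => T (aff t)) vs s.
  by apply: filterS (near_t _ Wt) => s Ws; rewrite E.
have [d1 _] := dD vs t Wt.
by have [d _] := near_eq_diff E1 d1; exact: d.
Qed.

Definition chart_segment M (x : M) (p q : 'rV[R]_(mdim M)) (t : R) : M :=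
  cinv (mchart x) (p + t *: (q - p)).

Lemma transition_domain_nbhs M (x y : M) p :
  (cmap (mchart x) @` (cdom (mchart x) `&` cdom (mchart y))) p ->
  nbhs p (cmap (mchart x) @` (cdom (mchart x) `&` cdom (mchart y))).
Proof.
move=> [z [xz yz] <-];
  apply: filterS (chart_pullback xz (chart_nbhs yz)) => q [Hq yq].
exists (cinv (mchart x) q); last exact: chart_invK.
by split=> //; exact: chart_inv_dom.
Qed.

Lemma chart_segment_smooth M (x : M) (p q : 'rV[R]_(mdim M)) U :
  (forall t, U t -> (cmap (mchart x) @` cdom (mchart x)) (p + t *: (q - p))) ->
  smooth_curve_on U (chart_segment x p q).
Proof.
move=> HU; split=> [t Ut|y].
  apply: (@continuous_comp _ _ _ (fun t : R => p + t *: (q - p))).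
    apply: cvgD; first exact: cvg_cst.
    by apply: scalel_continuous.
  exact: cinv_continuous (HU t Ut).
pose W := cmap (mchart x) @` (cdom (mchart x) `&` cdom (mchart y)).
have H := @smooth_on_affine _ _ W _ p (q - p) (@transition_domain_nbhs _ x y)
  (@chart_compat _ _ (mstruct M) x y).
move=> vs t [Ut yt]; apply: (H vs t);
  exists (cinv (mchart x) (p + t *: (q - p))).
  by split=> //; apply: chart_inv_dom; exact: HU.
by apply: chart_invK; exact: HU.
Qed.

Lemma chart_segment_speed M (g : riemMetric M) (x : M)
    (p q : 'rV[R]_(mdim M)) t :
  (cmap (mchart x) @` cdom (mchart x)) (p + t *: (q - p)) ->
  speed g (chart_segment x p q) t =
  Num.sqrt (inner (gram g x (p + t *: (q - p))) (q - p) (q - p)).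
Proof.
move=> Ht; pose aff (t : R) := p + t *: (q - p).
have daff : is_diff t aff ( *:%R^~ (q - p)).
  by apply: is_diff_eq; rewrite add0r.
have affc : {for t, continuous aff} by exact: differentiable_continuous.
have E : \forall s \near t, aff s = (cmap (mchart x) \o chart_segment x p q) s.
  have H : \forall s \near t, (cmap (mchart x) @` cdom (mchart x)) (aff s).
    exact: (affc _ (chart_img_nbhs Ht)).
  by apply: filterS H => s Hs; rewrite /= /chart_segment chart_invK.
have [daff1 daff2] := daff.
have [d J] := near_eq_diff E daff1.
rewrite (@speed_chart _ _ x).
- have -> : derive1 (cmap (mchart x) \o chart_segment x p q) t = q - p.
    exact: (etrans (derive1E' d)
      (etrans (congr1 (fun h => h 1) (etrans J daff2)) (scale1r _))).
  by rewrite [cmap _ _](chart_invK Ht).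
- exact: (continuous_comp affc (cinv_continuous Ht)).
- exact: chart_inv_dom.
- exact: d.
Qed.

(** Joint continuity of (p, w) |-> |w|_p. *)
Lemma speed_cvg M (g : riemMetric M) (x : M) (v : 'rV[R]_(mdim M)) e : 0 < e ->
  exists2 d, 0 < d & forall p w, `|p - cmap (mchart x) x| < d -> `|w - v| < d ->
    (cmap (mchart x) @` cdom (mchart x)) p /\
    Num.sqrt (inner (gram g x p) w w) <= Num.sqrt (inner (g x) v v) + e.
Proof.
move=> e0; pose c := cmap (mchart x) x.
have Hc : Num.sqrt (inner (gram g x z.1) z.2 z.2) @[z --> (c, v)] -->
    Num.sqrt (inner (gram g x c) v v).
  apply: (@continuous_cvg _ _ _ _ _ _ Num.sqrt); first exact: sqrt_continuous.
  apply: cvg_inner; [|exact: cvg_snd|exact: cvg_snd].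
  apply: (@cvg_comp _ _ _ fst (gram g x) _ (nbhs c)); first exact: cvg_fst.
  by apply: gram_cvg; exact: chart_img.
have He : \forall z \near (c, v), `|Num.sqrt (inner (gram g x c) v v) -
    Num.sqrt (inner (gram g x z.1) z.2 z.2)| <= e.
  exact: ((cvgrPdist_le _ _).1 Hc _ e0).
have Hd : \forall z \near (c, v), (cmap (mchart x) @` cdom (mchart x)) z.1.
  have : nbhs c (cmap (mchart x) @` cdom (mchart x)).
    by apply: chart_img_nbhs; exact: chart_img.
  exact: (@cvg_fst _ _ (nbhs c) (nbhs v)).
have [d d0 H] := near_norm (filterI Hd He); exists d => // p w pd wd.
have [|Hp /=] := H (p, w).
  by rewrite prod_normE /= gt_max pd wd.
rewrite gram_center ler_distlC => /andP[H1 H2]; split=> //.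
Qed.

(** The segment from p to q in the chart has constant coordinate velocity
q - p = h w, and the norm of w at its points is close to that of v at x. *)
Lemma chart_segment_dist M (g : riemMetric M) (x : M) (v : 'rV[R]_(mdim M)) e :
  0 < e -> exists2 d, 0 < d & forall p q h w,
    `|p - cmap (mchart x) x| < d -> `|q - cmap (mchart x) x| < d ->
    `|w - v| < d -> q - p = h *: w ->
    (riem_dist g (cinv (mchart x) p) (cinv (mchart x) q) <=
     ((Num.sqrt (inner (g x) v v) + e) * `|h|)%:E)%E.
Proof.
move=> e0; have [d d0 H] := speed_cvg g x v e0;
  exists d => // p q h w pd qd wd E.
pose c := cmap (mchart x) x.
pose U := [set t : R | `|p + t *: (q - p) - c| < d].
have oU : open U.
  rewrite (_ : U = (fun t : R => `|p + t *: (q - p) - c|) @^-1`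
    [set r | r < d])//.
  apply: open_comp; last exact: open_lt.
  move=> t _; apply: continuous_comp; last exact: norm_continuous.
  apply: cvgB; last exact: cvg_cst.
  by apply: cvgD; [exact: cvg_cst|exact: scalel_continuous].
have U01 t : t \in `[0, 1] -> U t by exact: ball_convex.
have Himg t : U t -> (cmap (mchart x) @` cdom (mchart x)) (p + t *: (q - p)).
  by move=> Ut; exact: (H _ w Ut wd).1.
have sc := chart_segment_smooth Himg.
have H01 : `[0%R, 1%R] `<=` U by move=> t; exact: U01.
have L : curve_length g (chart_segment x p q) <=
    (Num.sqrt (inner (g x) v v) + e) * `|h|.
  apply: (@Rintegral_segment_le (speed g (chart_segment x p q))) => t t01.
    exact: speed_continuous oU sc (U01 _ t01).
  rewrite chart_segment_speed; last exact: Himg (U01 _ t01).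
  rewrite E inner_scale sqrtrM ?sqr_ge0// sqrtr_sqr mulrC ler_wpM2r//.
  by rewrite -E; exact: (H _ w (U01 _ t01) wd).2.
apply: (@le_trans _ _ (curve_length g (chart_segment x p q))%:E);
  last by rewrite lee_fin.
(* 0 + L is the length which pw_path_snoc gives to a single curve. *)
apply: ereal_inf_lbound; exists (0 + curve_length g (chart_segment x p q));
  last first.
  by rewrite add0r.
have -> : cinv (mchart x) p = chart_segment x p q 0.
  by rewrite /chart_segment scale0r addr0.
have -> : cinv (mchart x) q = chart_segment x p q 1.
  by rewrite /chart_segment scale1r subrKC.
exact: (pw_path_snoc oU H01 sc (pw_path_nil _ _)).
Qed.

End Curves.

(** * Curves differentiable at one time *)
Section FirstOrder.
Context {R : realType}.
Implicit Types M N P : manifold R.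

Lemma curve_diffP {V : normedModType R} (z : R -> V) (t : R) (v : V) :
  is_diff t z ( *:%R^~ v) <->
  (forall e, 0 < e ->
    \forall s \near t, `|z s - z t - (s - t) *: v| <= e * `|s - t|).
Proof.
split=> [[d E] e e0|H].
  by have := diff_eps d e0; rewrite E.
have lin_scal : linear ( *:%R^~ v : R -> V).
  by move=> a b c; rewrite scalerDl scalerA.
pose scallM := GRing.isLinear.Build _ _ _ _ _ lin_scal.
pose scalL : {linear R -> V} := HB.pack ( *:%R^~ v : R -> V) scallM.
by apply: (@eps_diff _ _ _ _ scalL) => //; exact: scalel_continuous.
Qed.

(** Nothing is asked of the curve away from t: the lifts constructed below are
only known to be differentiable at one time. *)
Definition tangent M (d : R -> M) (t : R) (v : 'rV[R]_(mdim M)) : Prop :=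
  {for t, continuous d} /\ is_diff t (cmap (mchart (d t)) \o d) ( *:%R^~ v).

Lemma tangent_comp M N (f : M -> N) (d : R -> M) t v :
  tangent d t v -> mdiff f (d t) -> tangent (f \o d) t (v *m dmf f (d t)).
Proof.
move=> [dc dd] [fc fd]; split; first exact: (continuous_comp dc fc).
pose c := cmap (mchart (d t)) \o d.
have [cd cE] := dd.
have E : \forall s \near t, (local_expr f (d t) \o c) s =
    (cmap (mchart ((f \o d) t)) \o (f \o d)) s.
  have H : \forall s \near t, cdom (mchart (d t)) (d s).
    exact: (dc _ (chart_nbhs (mchart_dom (d t)))).
  by apply: filterS H => s Hs; rewrite /local_expr /c /= chartK.
have [D DE] := near_eq_diff E (differentiable_comp cd fd).
split; first exact: D.
transitivity ('d (local_expr f (d t) \o c) t : R -> _); first exact: DE.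
rewrite (diff_comp cd fd) cE; apply/funext => h /=.
by rewrite diff_jac -scalemxAl -dmfE.
Qed.

Lemma smooth_curve_tangent M U (gamma : R -> M) t : open U ->
  smooth_curve_on U gamma -> U t -> tangent gamma t (velocity gamma t).
Proof.
move=> oU [gc gs] Ut; split; first exact: gc.
have d : differentiable (cmap (mchart (gamma t)) \o gamma : R -> _) t.
  have gsR : @smooth_on R R _ (U `&` gamma @^-1` cdom (mchart (gamma t)))
    (cmap (mchart (gamma t)) \o gamma) by exact: gs.
  by apply: (smooth_on_diff gsR); split=> //; exact: mchart_dom.
by split; [exact: d|rewrite (diff1E d)].
Qed.

Definition rnorm M (g : riemMetric M) (x : M) (v : 'rV[R]_(mdim M)) : R :=
  Num.sqrt (inner (g x) v v).

(** The chart segment from d t to d s has velocity close to v, by the very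
definition of the derivative at t. *)
Lemma tangent_dist M (g : riemMetric M) (d : R -> M) t v e :
  tangent d t v -> 0 < e -> \forall s \near t,
    (riem_dist g (d t) (d s) <= ((rnorm g (d t) v + e) * `|s - t|)%:E)%E /\
    (riem_dist g (d s) (d t) <= ((rnorm g (d t) v + e) * `|s - t|)%:E)%E.
Proof.
move=> [dc dd] e0; have [r r0 H] := chart_segment_dist g (d t) v e0.
pose c := cmap (mchart (d t)) \o d.
have r2 : 0 < r / 2 by rewrite divr_gt0.
have near_c : \forall s \near t, `|c t - c s| < r.
  have : {for t, continuous c}.
    by apply: (continuous_comp dc); exact: cmap_continuous.
  by move=> /(cvgrPdist_lt _ _).1; exact.
have near_dom : \forall s \near t, cdom (mchart (d t)) (d s).
  exact: (dc _ (chart_nbhs (mchart_dom (d t)))).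
have near_lin := (curve_diffP _ _ _).1 dd _ r2.
apply: filterS3 near_c near_dom near_lin => s cs ds ls.
(* The difference quotient of d in the chart at d t, extended by v. *)
pose w := if s == t then v else (s - t)^-1 *: (c s - c t).
have wv : `|w - v| < r.
  rewrite /w; case: eqVneq => [_|st]; first by rewrite subrr normr0.
  have st0 : s - t != 0 by rewrite subr_eq0.
  rewrite -[v](scalerK st0) -scalerBr normrZ normfV ltr_pdivrMl ?normr_gt0//.
  apply: (le_lt_trans ls); rewrite mulrC ltr_pM2l ?normr_gt0//.
  by rewrite ltr_pdivrMr// ltr_pMr// ltr1n.
have hw : c s - c t = (s - t) *: w.
  rewrite /w; case: eqVneq => [->|st]; first by rewrite !subrr scale0r.
  by rewrite scalerKV// subr_eq0.
have Kt : cinv (mchart (d t)) (cmap (mchart (d t)) (d t)) = d t := mchartK _.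
have Ks : cinv (mchart (d t)) (c s) = d s by rewrite /c /= chartK.
have ct0 : `|cmap (mchart (d t)) (d t) - cmap (mchart (d t)) (d t)| < r.
  by rewrite subrr normr0.
have cs0 : `|c s - cmap (mchart (d t)) (d t)| < r by rewrite distrC.
split; first by have := H _ _ _ _ ct0 cs0 wv hw; rewrite Kt Ks.
have hwN : c t - c s = - (s - t) *: w by rewrite scaleNr -hw opprB.
by have := H _ _ _ _ cs0 ct0 wv hwN; rewrite Kt Ks normrN.
Qed.

(** Correct the line p + (s - t) k by [strict_diff_solve]. As k J = v, the
defect F (x s) - y s is o(s - t), hence so is the correction, and the velocity
at t remains k. *)
Lemma solve_curve n m (F : 'rV[R]_n -> 'rV[R]_m) p J (A : 'M[R]_(m, n))
    (y : R -> 'rV[R]_m) t v k :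
  strict_diff F p J -> A *m J = 1%:M -> y t = F p ->
  is_diff t y ( *:%R^~ v) -> k *m J = v ->
  exists z : R -> 'rV[R]_n, [/\ z t = p, is_diff t z ( *:%R^~ k) &
    \forall s \near t, F (z s) = y s].
Proof.
move=> sF AJ yt dy kJ.
have [d d0 H] := strict_diff_solve sF AJ.
pose x (s : R) := p + (s - t) *: k.
have xc : {for t, continuous x}.
  apply: cvgD; first exact: cvg_cst.
  apply: cvgZr_tmp.
  apply: cvgB; [exact: cvg_id|exact: cvg_cst].
have xt : x t = p by rewrite /x subrr scale0r addr0.
have [dy1 dy2] := dy.
have near_x : \forall s \near t, `|x s - p| < d.
  have := (cvgrPdist_lt _ _).1 xc _ d0; rewrite xt.
  by move=> Hx; near=> s; rewrite distrC; near: s; exact: Hx.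
have near_y : \forall s \near t, `|y s - F p| < d.
  have := (cvgrPdist_lt _ _).1 (differentiable_continuous dy1) _ d0.
  by move=> Hy; near=> s; rewrite -yt distrC; near: s; exact: Hy.
have Hex (s : R) : exists w : 'rV[R]_m, `|x s - p| < d -> `|y s - F p| < d ->
    F (x s + w *m A) = y s /\ `|w| <= 2 * `|F (x s) - y s|.
  have [xs|xs] := pselect (`|x s - p| < d); last by exists 0.
  have [ys|ys] := pselect (`|y s - F p| < d); last by exists 0.
  by have [w ? ?] := H _ _ xs ys; exists w.
have [w Hw] := choice Hex.
have wt : w t = 0.
  have [_] := Hw t (nbhs_singleton near_x) (nbhs_singleton near_y).
  by rewrite xt yt subrr normr0 mulr0 normr_le0 => /eqP.
exists (fun s => x s + w s *m A); split.
- by rewrite wt mul0mx addr0.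
- apply/curve_diffP => e e0.
  rewrite wt mul0mx addr0 xt.
  (* The correction is at most b times 2 times the defect, which is the sum of
     the errors of F, at most e2 |k| |s - t|, and of y, at most e1 |s - t|. *)
  pose b := m%:R * `|A| + 1.
  have b0 : 0 < b by rewrite ltr_wpDl// mulr_ge0.
  pose K := `|k| + 1.
  have K0 : 0 < K by rewrite ltr_wpDl.
  pose e1 := e / (4 * b).
  have e10 : 0 < e1 by rewrite divr_gt0// mulr_gt0.
  pose e2 := e1 / K.
  have e20 : 0 < e2 by rewrite divr_gt0.
  have [d' d'0 H'] := sF _ e20.
  have near_x' : \forall s \near t, `|x s - p| < d'.
    have := (cvgrPdist_lt _ _).1 xc _ d'0; rewrite xt.
    by move=> Hx; near=> s; rewrite distrC; near: s; exact: Hx.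
  have near_lin := (curve_diffP _ _ _).1 dy _ e10.
  near=> s.
  have [_ ws] : F (x s + w s *m A) = y s /\ `|w s| <= 2 * `|F (x s) - y s|.
    by apply: Hw; near: s.
  have -> : x s + w s *m A - p - (s - t) *: k = w s *m A.
    by rewrite /x; apply/rowP => i; rewrite !mxE; ring.
  have wA : `|w s *m A| <= b * `|w s|.
    by rewrite (le_trans (mulmx_norm_le _ _))// mulrAC ler_wpM2r// lerDl.
  have xs' : `|x s - p| < d' by near: s.
  have pp : `|p - p| < d' by rewrite subrr normr0.
  have := H' _ _ xs' pp.
  have -> : x s - p = (s - t) *: k by rewrite /x addrAC subrr add0r.
  rewrite -scalemxAl kJ normrZ => HF.
  have HF1 : `|F (x s) - F p - (s - t) *: v| <= e1 * `|s - t|.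
    apply: (le_trans HF); rewrite mulrCA mulrC ler_wpM2r// /e2 -mulrA.
    by rewrite ler_piMr ?(ltW e10)// ler_pdivrMl// mulr1 lerDl.
  have Hy : `|y s - y t - (s - t) *: v| <= e1 * `|s - t| by near: s.
  have res : `|F (x s) - y s| <= 2 * e1 * `|s - t|.
    have -> : F (x s) - y s = (F (x s) - F p - (s - t) *: v) -
        (y s - y t - (s - t) *: v).
      by rewrite yt; apply/rowP => i; rewrite !mxE; ring.
    rewrite (le_trans (ler_normB _ _))// -mulrA mulrDl mul1r.
    exact: lerD.
  rewrite (le_trans wA)// (le_trans (ler_wpM2l (ltW b0) ws))//.
  rewrite (le_trans (ler_wpM2l (ltW b0) (ler_wpM2l _ res)))//.
  rewrite [leLHS](_ : _ = e * `|s - t|)// /e1; field.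
  exact: lt0r_neq0.
- by near=> s;
    have [] : F (x s + w s *m A) = y s /\ `|w s| <= 2 * `|F (x s) - y s|;
    [apply: Hw; near: s|].
Unshelve. all: by end_near. Qed.

End FirstOrder.

(** * Orthogonal projections and Riemannian submersions *)
Section InnerProduct.
Context {R : realType} {n : nat} (A : 'M[R]_n).
Hypotheses (A_sym : A^T = A) (A_pos : forall v, v != 0 -> 0 < inner A v v).

Lemma inner_sym v w : inner A v w = inner A w v.
Proof.
have -> : inner A w v = (w *m A *m v^T)^T 0 0 by rewrite mxE.
by rewrite !trmx_mul trmxK A_sym mulmxA.
Qed.

Lemma innerDl u v w : inner A (u + v) w = inner A u w + inner A v w.
Proof. by rewrite /inner !mulmxDl mxE. Qed.

Lemma innerDr u v w : inner A u (v + w) = inner A u v + inner A u w.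
Proof. by rewrite inner_sym innerDl !(inner_sym u). Qed.

Lemma inner_ge0 v : 0 <= inner A v v.
Proof.
have [->|v0] := eqVneq v 0; last exact: ltW (A_pos v0).
by rewrite /inner !mul0mx mxE.
Qed.

(** The kernel form is the one in which [horizontal] takes orthogonal
complements. *)
Definition orth_mx k (K : 'M[R]_(k, n)) : 'M[R]_n := kermx (A *m K^T).

Lemma orth_mxP k (K : 'M[R]_(k, n)) u :
  reflect (forall c : 'rV_n, (c <= K)%MS -> inner A u c = 0)
    (u <= orth_mx K)%MS.
Proof.
apply: (iffP (@sub_kermxP _ _ _ _ _ _)) => [uK c /submxP[d ->]|uK].
  by rewrite /inner trmx_mul !mulmxA -[u *m A *m _]mulmxA uK mul0mx mxE.
apply/rowP => i; rewrite mulmxA [RHS]mxE -[RHS](uK (row i K)) ?row_sub//.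
by rewrite /inner !mxE; apply: eq_bigr => j _; rewrite !mxE.
Qed.

Lemma orth_mx_disjoint k (K : 'M[R]_(k, n)) : (orth_mx K :&: K = 0)%MS.
Proof.
apply/eqP/rowV0P => u; rewrite sub_capmx => /andP[/orth_mxP uK uinK].
apply/eqP; apply: contraT => u0.
by have := A_pos u0; rewrite uK// ltxx.
Qed.

Lemma orth_mx_full k (K : 'M[R]_(k, n)) (u : 'rV_n) : (u <= orth_mx K + K)%MS.
Proof.
apply: submx_full; rewrite /row_full eqn_leq rank_leq_col /=.
have := mxrank_sum_cap (orth_mx K) K.
rewrite orth_mx_disjoint mxrank0 addn0 mxrank_ker => ->.
have : (\rank (A *m K^T) <= \rank K)%N.
  by rewrite -[leqRHS]mxrank_tr mxrankM_maxr.
by move=> H; rewrite (leq_trans _ (leq_add (leqnn _) H))// addnC -leq_subLR.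
Qed.

Definition orth_proj (K : 'M[R]_n) (u : 'rV[R]_n) := u *m proj_mx (orth_mx K) K.

Lemma orth_proj_sub (K : 'M[R]_n) u : (u - orth_proj K u <= K)%MS.
Proof.
have := add_proj_mx (orth_mx_disjoint K) (orth_mx_full K u).
move=> E; rewrite -{1}E /orth_proj addrC addKr proj_mx_sub//.
Qed.

Lemma orth_proj_orth (K : 'M[R]_n) u (c : 'rV_n) : (c <= K)%MS ->
  inner A (orth_proj K u) c = 0.
Proof. by apply/orth_mxP; exact: proj_mx_sub. Qed.

Lemma orth_proj_le (K : 'M[R]_n) u :
  inner A (orth_proj K u) (orth_proj K u) <= inner A u u.
Proof.
have orth := orth_proj_orth u (orth_proj_sub K u).
have {3 4}-> : u = orth_proj K u + (u - orth_proj K u) by rewrite subrKC.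
move: (orth_proj K u) (u - _) orth => h c orth.
by rewrite innerDl !innerDr orth addr0 inner_sym orth add0r lerDl inner_ge0.
Qed.

Lemma orth_proj_congr (K : 'M[R]_n) u v : (u - v <= K)%MS ->
  orth_proj K u = orth_proj K v.
Proof.
move=> uv; apply/eqP; rewrite -subr_eq0 -mulmxBl.
by rewrite proj_mx_0// orth_mx_disjoint.
Qed.

End InnerProduct.

Section RiemSubmersion.
Context {R : realType} {M N : manifold R}.
Variables (gM : riemMetric M) (gN : riemMetric N) (f : M -> N).
Hypothesis f_riem : riem_submersion gM gN f.

Lemma dmf_mfd x : dmf f x = mfd f x. Proof. by rewrite dmf.unlock. Qed.

Lemma riem_submersion_full x : row_full (dmf f x).
Proof. by rewrite dmf_mfd; have [[_ ]] := f_riem. Qed.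

Lemma riem_submersion_horizontal x v :
  (forall k, k *m dmf f x = 0 -> inner (gM x) v k = 0) ->
  inner (gN (f x)) (v *m dmf f x) (v *m dmf f x) = inner (gM x) v v.
Proof. by rewrite dmf_mfd => vh; have [_] := f_riem; apply. Qed.

(** The vector h is the component of v orthogonal to the kernel of df. *)
Lemma riem_submersion_decomp x v : exists h, [/\ h *m dmf f x = v *m dmf f x,
  inner (gN (f x)) (h *m dmf f x) (h *m dmf f x) = inner (gM x) h h
  & inner (gM x) h h <= inner (gM x) v v].
Proof.
pose K := kermx (dmf f x).
have sym := metric_sym gM x; have pos := @metric_pos _ _ gM x.
exists (orth_proj (gM x) K v); split; last exact: orth_proj_le.
  apply/eqP; rewrite eq_sym -subr_eq0 -mulmxBl.
  by apply/eqP/sub_kermxP; exact: orth_proj_sub.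
apply: riem_submersion_horizontal => k kf.
by apply: orth_proj_orth => //; apply/sub_kermxP.
Qed.

Lemma riem_submersion_contracts x v :
  inner (gN (f x)) (v *m dmf f x) (v *m dmf f x) <= inner (gM x) v v.
Proof. by have [h [<- -> ?]] := riem_submersion_decomp x v. Qed.

Lemma riem_submersion_lift x w : exists2 v, v *m dmf f x = w &
  inner (gM x) v v = inner (gN (f x)) w w.
Proof.
have [h [E1 E2 _]] := riem_submersion_decomp x (w *m pinvmx (dmf f x)).
have E : h *m dmf f x = w.
  by rewrite E1 -mulmxA mulVpmx ?mulmx1// riem_submersion_full.
by exists h => //; rewrite -E2 E.
Qed.

End RiemSubmersion.

(** * Inversion and target contract lengths *)
Section GroupoidAlgebra.
Context {R : realType} (G : lieGroupoid R).
Implicit Types (p q : comp G) (g h : arr G).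

(** The law (gh)^-1 = h^-1 g^-1: the product (gh) (h^-1 g^-1) is a unit by
associativity, and inverses are unique. *)
Lemma mul_swap p : inv (mul p) = mul (swap_triangle p).
Proof.
pose s := swap_triangle p; set x := mul p; set y := mul s.
have e_hy : src (csnd p) = tgt y by rewrite /y tgt_mul /= tgt_inv.
have e_xy : src x = tgt y by rewrite src_mul e_hy.
have e_hh : src (csnd p) = tgt (inv (csnd p)) by rewrite tgt_inv.
have e_gg : src (cfst p) = tgt (inv (cfst p)) by rewrite tgt_inv.
have e_hhg : src (mul (cpair e_hh)) = tgt (inv (cfst p)).
  by rewrite src_mul /= src_inv tgt_inv (composableP p).
have hy : mul (cpair e_hy) = inv (cfst p).
  rewrite -(@mul_assoc _ G (cpair e_hh) s (cpair e_hhg) (cpair e_hy))//.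
  by apply: (@mul_unit_l _ G _ (tgt (csnd p))); exact: mul_inv_r.
have e_ghy : src (cfst p) = tgt (mul (cpair e_hy)) by rewrite hy.
have xy : mul (cpair e_xy) = unit (tgt x).
  rewrite (@mul_assoc _ G p (cpair e_hy) (cpair e_xy) (cpair e_ghy))//.
  by rewrite /x tgt_mul; apply: mul_inv_r; exact: hy.
have e_xx : src (inv x) = tgt x by rewrite src_inv.
have e_xxy : src (mul (cpair e_xx)) = tgt y by rewrite src_mul.
have e_xxy' : src (inv x) = tgt (mul (cpair e_xy)) by rewrite tgt_mul.
have := @mul_assoc _ G (cpair e_xx) (cpair e_xy) (cpair e_xxy) (cpair e_xxy')
  erefl erefl erefl erefl erefl.
rewrite (@mul_unit_l _ G (cpair e_xxy) (src x)); last exact: mul_inv_l.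
rewrite (@mul_unit_r _ G (cpair e_xxy') (tgt x)); last exact: xy.
by move/esym.
Qed.

(** The space of composable pairs has the topology induced by G * G. *)
Lemma comp_continuous (T : topologicalType) (f : T -> comp G) x :
  {for x, continuous (cfst \o f)} -> {for x, continuous (csnd \o f)} ->
  {for x, continuous f}.
Proof.
move=> c1 c2.
have H : {for x, continuous (fun y => ((cfst \o f) y, (csnd \o f) y))}.
  exact: cvg_pair.
move=> A [B [[C oC <-] /= Cfx] BA].
have : nbhs (cfst (f x), csnd (f x)) C.
  apply: open_nbhs_nbhs; split=> //.
  by rewrite -surjective_pairing.
move=> /H HC;
  have {}HC : \forall y \near x, C ((cfst \o f) y, (csnd \o f) y) by exact: HC.
have : \forall y \near x, A (f y).
  apply: filterS HC => y Cy; apply: BA => /=.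
  by move: Cy; rewrite /= -surjective_pairing.
exact.
Qed.

Lemma swap_continuous p : {for p, continuous (@swap_triangle R G)}.
Proof.
have c1 : {for p, continuous (cfst : comp G -> arr G)}.
  exact: smooth_map_continuous (@cfst_smooth _ G).
have c2 : {for p, continuous (csnd : comp G -> arr G)}.
  exact: smooth_map_continuous (@csnd_smooth _ G).
have ci g : {for g, continuous (@inv R G)}.
  exact: smooth_map_continuous (@inv_smooth _ G).
by apply: comp_continuous; [exact: (continuous_comp c2 (ci _))|
                            exact: (continuous_comp c1 (ci _))].
Qed.

(** Its two components, the inverses of the projections, are smooth, and the
inclusion of composable pairs in G * G is an immersion: [diff_immersion] then
applies to the swap. *)
Lemma swap_mdiff p : mdiff (@swap_triangle R G) p.
Proof.
split; first exact: swap_continuous.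
pose s := @swap_triangle R G; pose q := s p.
pose F1 : comp G -> arr G := cfst; pose F2 : comp G -> arr G := csnd.
have [d1 _] := mdiff_comp (smooth_mdiff p (@csnd_smooth _ G))
                     (smooth_mdiff (csnd p) (@inv_smooth _ G)).
have [d2 _] := mdiff_comp (smooth_mdiff p (@cfst_smooth _ G))
                     (smooth_mdiff (cfst p) (@inv_smooth _ G)).
have [_ e1] := smooth_mdiff q (@cfst_smooth _ G).
have [_ e2] := smooth_mdiff q (@csnd_smooth _ G).
pose i z := row_mx (local_expr F1 q z) (local_expr F2 q z).
have [di Ji] := jac_row_mx e1 e2.
have E : \forall z \near cmap (mchart p) p,
    row_mx (local_expr (F1 \o s) p z) (local_expr (F2 \o s) p z)
    = (i \o local_expr s p) z.
  apply: filterS (local_expr_near (@swap_continuous p)) => z [_ _ H].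
  by rewrite /i /= /local_expr /= H.
have [dr _] := jac_row_mx d1.2 d2.2.
have [dis _] := jac_near E dr.
apply: (@diff_immersion _ _ _ _ _ i _ (pinvmx (row_mx (dmf F1 q) (dmf F2 q)))).
- exact: local_expr_continuous (@swap_continuous p).
- by rewrite local_expr_center.
- exact: dis.
rewrite local_expr_center Ji -!dmfE mulmxVp//.
rewrite -kermx_eq0; apply/rowV0P => v /sub_kermxP; rewrite mul_mx_row => vJ.
have := @comp_immersion _ G q v; rewrite -!dmf_mfd.
move/(congr1 lsubmx): (vJ); move/(congr1 rsubmx): vJ.
rewrite row_mxKl row_mxKr !linear0 => E2 E1 H.
by apply: H; [exact: E1|exact: E2].
Qed.

End GroupoidAlgebra.

Section RiemGroupoid.
Context {R : realType} (G : riemGroupoid R).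

(** Lift v orthogonally through the multiplication to a vector at a pair (g, 1),
swap the pair, which is an isometry, and multiply again, which contracts; by
[mul_swap] the result is the image of v under the inversion. *)
Lemma inv_contracts (g : arr G) v :
  inner (eta1 G (inv g)) (v *m dmf (@inv R G) g) (v *m dmf (@inv R G) g) <=
  inner (eta1 G g) v v.
Proof.
have e : src g = tgt (unit (src g)) by rewrite tgt_unit.
have -> : g = mul (cpair e) by rewrite (@mul_unit_r _ G _ (src g)).
move: (cpair e) => p; move: v => v {e g}.
have [u <- <-] := riem_submersion_lift (eta1_induced G) p v.
have dmul q := smooth_mdiff q (@mul_smooth _ G).
have [_ D1] := mdiff_comp (dmul p) (smooth_mdiff (mul p) (@inv_smooth _ G)).
have [_ D2] := mdiff_comp (@swap_mdiff _ G p) (dmul (swap_triangle p)).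
have E : @inv R G \o @mul R G = @mul R G \o @swap_triangle R G.
  by apply/funext => q; exact: mul_swap.
rewrite -mulmxA -D1 E D2 mulmxA mul_swap.
apply: le_trans (riem_submersion_contracts (eta1_induced G) _ _) _.
have := @eta2_swap _ G p u u; rewrite -dmf_mfd => ->.
by [].
Qed.

Lemma tgt_contracts (g : arr G) v :
  inner (eta0 G (tgt g)) (v *m dmf (@tgt R G) g) (v *m dmf (@tgt R G) g) <=
  inner (eta1 G g) v v.
Proof.
have [_ D] := mdiff_comp (smooth_mdiff g (@inv_smooth _ G))
  (smooth_mdiff (inv g) (@src_submersion _ G).1).
have E : @src R G \o @inv R G = @tgt R G by apply/funext => h; exact: src_inv.
rewrite -E D mulmxA /=.
apply: le_trans (riem_submersion_contracts (eta0_induced G) _ _) _.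
exact: inv_contracts.
Qed.

End RiemGroupoid.

(** * Moving curves along orbits *)
Section OrbitMotion.
Context {R : realType}.
Implicit Types G H : riemGroupoid R.

Lemma rnorm_le (M N : manifold R) (gM : riemMetric M) (gN : riemMetric N)
    x y v w :
  inner (gM x) v v <= inner (gN y) w w -> rnorm gM x v <= rnorm gN y w.
Proof. exact: ler_wsqrtr. Qed.

Lemma chart_curve_tangent (M : manifold R) (x : M)
    (z : R -> 'rV[R]_(mdim M)) t k :
  z t = cmap (mchart x) x -> is_diff t z ( *:%R^~ k) ->
  tangent (fun s => cinv (mchart x) (z s)) t k.
Proof.
move=> zt [zd1 zd2].
have zc := differentiable_continuous zd1.
have img_near : nbhs (z t) (cmap (mchart x) @` cdom (mchart x)).
  by rewrite zt; apply: chart_img_nbhs; exact: chart_img (mchart_dom x).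
split.
  apply: (continuous_comp zc); apply: cinv_continuous.
  exact: nbhs_singleton img_near.
rewrite zt mchartK.
have E : \forall s \near t,
    z s = (cmap (mchart x) \o (fun s => cinv (mchart x) (z s))) s.
  have : \forall s \near t, (cmap (mchart x) @` cdom (mchart x)) (z s).
    exact: (zc _ img_near).
  by apply: filterS => s Hs; rewrite /= chart_invK.
by have := near_eq_diff E zd1; rewrite zd2.
Qed.

Lemma local_expr_curve (M N : manifold R) (f : M -> N) (x : M)
    (z : R -> 'rV[R]_(mdim M)) t :
  smooth_map f -> z t = cmap (mchart x) x -> {for t, continuous z} ->
  \forall s \near t, cinv (mchart (f x)) (local_expr f x (z s)) =
    f (cinv (mchart x) (z s)).
Proof.
move=> sf zt zc.
have : nbhs (z t) [set p | cinv (mchart (f x)) (local_expr f x p) =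
    f (cinv (mchart x) p)].
  rewrite zt; apply: filterS (local_expr_near (smooth_map_continuous sf)).
  by move=> p [].
by move=> /zc.
Qed.

(** A case of [solve_curve] in charts at x and f x. *)
Lemma lift_curve (M N : manifold R) (f : M -> N) (c : R -> N) t x v k :
  smooth_map f -> row_full (dmf f x) -> f x = c t -> tangent c t v ->
  k *m dmf f x = v ->
  exists b : R -> M,
    [/\ b t = x, tangent b t k & \forall s \near t, f (b s) = c s].
Proof.
move=> sf full fx [cc cd] kv.
pose y := cmap (mchart (f x)) \o c.
have yd : is_diff t y ( *:%R^~ v) by rewrite /y fx.
have yt : y t = local_expr f x (cmap (mchart x) x).
  by rewrite local_expr_center /y /= fx.
have [z [zt zd zy]] :=
  solve_curve (smooth_strict_diff x sf) (mulVpmx full) yt yd kv.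
have [zd1 _] := zd.
have bt : cinv (mchart x) (z t) = x by rewrite zt mchartK.
exists (fun s => cinv (mchart x) (z s)); split; first exact: bt.
  exact: chart_curve_tangent.
have H1 := local_expr_curve sf zt (differentiable_continuous zd1).
have H2 : \forall s \near t, cdom (mchart (f x)) (c s).
  by apply: cc; rewrite -fx; exact: chart_nbhs (mchart_dom _).
by apply: filterS3 zy H1 H2 => s -> <- Hs; rewrite /y /= chartK.
Qed.

(** Lift c through the source map to a curve of arrows with velocity k, and take
the targets. *)
Lemma move_curve (G : lieGroupoid R) (c : R -> obj G) t v (g : arr G) k :
  src g = c t -> tangent c t v -> k *m dmf (@src R G) g = v ->
  exists b : R -> obj G, [/\ b t = tgt g, tangent b t (k *m dmf (@tgt R G) g) &
    \forall s \near t, same_orbit (c s) (b s)].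
Proof.
move=> sg ct kv; have [ssrc srcfull] := @src_submersion _ G.
have full : row_full (dmf (@src R G) g) by rewrite dmf_mfd.
have [a [at_ atan asrc]] := lift_curve ssrc full sg ct kv.
exists (@tgt R G \o a); split; first by rewrite /= at_.
  have := tangent_comp atan (smooth_mdiff (a t) (@tgt_submersion _ G).1).
  by rewrite at_.
by apply: filterS asrc => s Hs; exists (a s).
Qed.

Lemma orbit_tangentP (G : lieGroupoid R) (x : obj G)
    (u : 'rV[R]_(mdim (obj G))) :
  reflect (exists2 a, a *m dmf (@src R G) (unit x) = 0 &
                      a *m dmf (@tgt R G) (unit x) = u)
          (u <= orbit_tangent x)%MS.
Proof.
rewrite /orbit_tangent genmxE -!dmf_mfd;
  apply: (iffP submxP) => [[d ->]|[a a0 <-]].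
  exists (d *m kermx (dmf (@src R G) (unit x))); last by rewrite mulmxA.
  by rewrite -mulmxA mulmx_ker mulmx0.
by have /submxP[d ->] : (a <= kermx (dmf (@src R G) (unit x)))%MS;
  [apply/sub_kermxP|exists d; rewrite mulmxA].
Qed.

Lemma dmf_section (M N : manifold R) (f : M -> N) (g : N -> M) x :
  smooth_map f -> smooth_map g -> (forall y, f (g y) = y) ->
  dmf g x *m dmf f (g x) = 1%:M.
Proof.
move=> sf sg fg.
have [_ <-] := mdiff_comp (smooth_mdiff x sg) (smooth_mdiff (g x) sf).
have -> : f \o g = id by apply/funext => y; exact: fg.
by have [_ ->] := mdiff_id x.
Qed.

Lemma unit_src (G : lieGroupoid R) (x : obj G) :
  dmf (@unit R G) x *m dmf (@src R G) (unit x) = 1%:M.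
Proof.
exact: (dmf_section x (@src_submersion _ G).1 (@unit_smooth _ G)
  (@src_unit _ G)).
Qed.

Lemma unit_tgt (G : lieGroupoid R) (x : obj G) :
  dmf (@unit R G) x *m dmf (@tgt R G) (unit x) = 1%:M.
Proof.
exact: (dmf_section x (@tgt_submersion _ G).1 (@unit_smooth _ G)
  (@tgt_unit _ G)).
Qed.

(** The projection in [horizontal] is the orthogonal one, so that the lemmas
above on inner products apply. *)
Lemma horizontalE G (x : obj G) v :
  horizontal (eta0 G) x v = orth_proj (eta0 G x) (orbit_tangent x) v.
Proof. by []. Qed.

Lemma normal_inner_le G (x : obj G) v :
  normal_inner (eta0 G) x v v <= inner (eta0 G x) v v.
Proof.
rewrite /normal_inner horizontalE; apply: orth_proj_le; first exact: metric_sym.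
exact: metric_pos.
Qed.

Lemma normal_inner_congr G (x : obj G) v w : normal_eq x v w ->
  normal_inner (eta0 G) x v v = normal_inner (eta0 G) x w w.
Proof.
move=> vw; rewrite /normal_inner !horizontalE.
by rewrite (orth_proj_congr (@metric_pos _ _ (eta0 G) x) vw).
Qed.

Lemma horizontal_sub G (x : obj G) v :
  (v - horizontal (eta0 G) x v <= orbit_tangent x)%MS.
Proof.
rewrite horizontalE; apply: orth_proj_sub; first exact: metric_pos.
Qed.

(** Write v - h, tangent to the orbit, as the target component of a vector a in
the kernel of ds. Arrows that start at c and leave the unit at c t with velocity
d1(v) - a have targets with velocity v - (v - h) = h. *)
Lemma straighten_curve G (c : R -> obj G) t v : tangent c t v ->
  exists b : R -> obj G,
    [/\ b t = c t, tangent b t (horizontal (eta0 G) (c t) v) &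
    \forall s \near t, same_orbit (c s) (b s)].
Proof.
move=> ct; set h := horizontal _ _ _; pose x := c t.
have /orbit_tangentP[a as0 at_] := horizontal_sub (c t) v.
have kv : (v *m dmf (@unit R G) x - a) *m dmf (@src R G) (unit x) = v.
  by rewrite mulmxBl -mulmxA unit_src mulmx1 as0 subr0.
have [b [bt btan bc]] := move_curve (src_unit x) ct kv.
exists b; split=> //; first by rewrite bt tgt_unit.
move: btan; rewrite mulmxBl -mulmxA unit_tgt mulmx1 at_.
by rewrite opprB addrC subrK.
Qed.

(** Straighten phi \o c. The horizontal part of dphi(v) has the length of the
class of v in the normal space, as the derivative of phi is isometric on normal
spaces. *)
Lemma push_curve H G (phi : groupoidMap H G) (c : R -> obj H) t v :
  riem_morita phi -> tangent c t v ->
  exists b : R -> obj G, exists w, [/\ tangent b t w,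
    rnorm (eta0 G) (b t) w <= rnorm (eta0 H) (c t) v &
    \forall s \near t, orbit_class (b s) = orbit_map phi (orbit_class (c s))].
Proof.
move=> [_ phi_iso] ct.
have pt := tangent_comp ct (smooth_mdiff (c t) (fobj_smooth phi)).
have [b [bt btan bc]] := straighten_curve pt.
exists b, (horizontal (eta0 G) ((fobj phi \o c) t) (v *m dmf (fobj phi) (c t)));
  split=> //.
  rewrite bt; apply: rnorm_le; apply: (le_trans _ (normal_inner_le (c t) v)).
  by rewrite -phi_iso -!dmf_mfd.
apply: filterS bc => s Hs; rewrite orbit_mapE; apply/orbit_classP.
by have [g [sg tg]] := Hs; exists (inv g); rewrite src_inv tgt_inv.
Qed.

(** * Lifting curves along Morita maps *)
Lemma groupoidMap_orbit_tangent (H G : lieGroupoid R) (phi : groupoidMap H G)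
    (x : obj H) (u : 'rV[R]_(mdim (obj H))) :
  (u <= orbit_tangent x)%MS ->
  (u *m dmf (fobj phi) x <= orbit_tangent (fobj phi x))%MS.
Proof.
move=> /orbit_tangentP[a as0 <-]; apply/orbit_tangentP.
have dfarr := smooth_mdiff (unit x) (farr_smooth phi).
have dfobj y := smooth_mdiff y (fobj_smooth phi).
have dsrc (K : lieGroupoid R) g := smooth_mdiff g (@src_submersion _ K).1.
have dtgt (K : lieGroupoid R) g := smooth_mdiff g (@tgt_submersion _ K).1.
exists (a *m dmf (farr phi) (unit x)).
  have [_ E1] := mdiff_comp dfarr (dsrc G (farr phi (unit x))).
  have [_ E2] := mdiff_comp (dsrc H (unit x)) (dfobj (src (unit x))).
  have E : @src R G \o farr phi = fobj phi \o @src R H.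
    by apply/funext => g; exact: src_farr.
  rewrite -farr_unit -mulmxA -E1 E E2 mulmxA as0 mul0mx//.
have [_ E1] := mdiff_comp dfarr (dtgt G (farr phi (unit x))).
have [_ E2] := mdiff_comp (dtgt H (unit x)) (dfobj (tgt (unit x))).
have E : @tgt R G \o farr phi = fobj phi \o @tgt R H.
  by apply/funext => g; exact: tgt_farr.
by rewrite -farr_unit -mulmxA -E1 E E2 mulmxA tgt_unit.
Qed.

Lemma row_full_surj m n (J : 'M[R]_(m, n)) :
  (forall w : 'rV_n, exists z : 'rV_m, z *m J = w) -> row_full J.
Proof.
move=> H; rewrite -sub1mx; apply/row_subP => i.
by have [z <-] := H (row i 1%:M); exact: submxMl.
Qed.

(** The system phi x = s(h), t(h) = z is transverse at (y, 1). Take v such that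
dphi(v) is p + q modulo the orbit, with difference the target component of a in
the kernel of ds, and h-component d1(dphi(v) - p) - a. *)
Lemma fibre_surj (H G : lieGroupoid R) (phi : groupoidMap H G) y p q :
  normal_iso phi y -> exists (v : 'rV_(mdim (obj H))) (k : 'rV_(mdim (arr G))),
    v *m dmf (fobj phi) y - k *m dmf (@src R G) (unit (fobj phi y)) = p /\
    k *m dmf (@tgt R G) (unit (fobj phi y)) = q.
Proof.
move=> [_ /(_ (p + q))[v]]; rewrite -dmf_mfd => /orbit_tangentP[a as0 at_].
exists v, ((v *m dmf (fobj phi) y - p) *m dmf (@unit R G) (fobj phi y) - a).
rewrite !mulmxBl -!mulmxA unit_src unit_tgt !mulmx1 as0 at_ subr0 subKr.
by split=> //; apply/rowP => i; rewrite !mxE; ring.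
Qed.

Section FibreMap.
Variables (a b m n : nat) (Phi : 'rV[R]_a -> 'rV[R]_m).
Variables (S : 'rV[R]_b -> 'rV[R]_m) (T : 'rV[R]_b -> 'rV[R]_n).

(** The zeros of the first block are the expression in charts of the fibre
product of phi and s over the objects of G; the second block is the target. *)
Definition fibre_map (z : 'rV[R]_(a + b)) : 'rV[R]_(m + n) :=
  row_mx (Phi (lsubmx z) - S (rsubmx z)) (T (rsubmx z)).

Definition fibre_jac (DPhi : 'M[R]_(a, m)) (DS : 'M[R]_(b, m))
  (DT : 'M[R]_(b, n)) : 'M[R]_(a + b, m + n) := block_mx DPhi 0 (- DS) DT.

Lemma mul_fibre_jac DPhi DS DT (z : 'rV[R]_(a + b)) :
  z *m fibre_jac DPhi DS DT =
  row_mx (lsubmx z *m DPhi - rsubmx z *m DS) (rsubmx z *m DT).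
Proof.
by rewrite -[in LHS](hsubmxK z) mul_row_block mulmx0 add0r mulmxN.
Qed.

Lemma strict_diff_fibre_map p q DPhi DS DT :
  strict_diff Phi p DPhi -> strict_diff S q DS -> strict_diff T q DT ->
  strict_diff fibre_map (row_mx p q) (fibre_jac DPhi DS DT).
Proof.
move=> sPhi sS sT r r0; have r2 : 0 < r / 2 by rewrite divr_gt0.
have [d1 d10 H1] := sPhi _ r2; have [d2 d20 H2] := sS _ r2;
  have [d3 d30 H3] := sT _ r0.
exists (Num.min d1 (Num.min d2 d3)); first by rewrite !lt_min d10 d20 d30.
move=> z1 z2; rewrite !lt_min => /and3P[a1 a2 a3] /and3P[b1 b2 b3].
have lp (z : 'rV[R]_(a + b)) r' : `|z - row_mx p q| < r' ->
  `|lsubmx z - p| < r'.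
  move=> zr; apply: le_lt_trans zr.
  by rewrite -[p in `|_ - p|](row_mxKl _ q) -linearB lsubmx_norm_le.
have rp (z : 'rV[R]_(a + b)) r' : `|z - row_mx p q| < r' ->
  `|rsubmx z - q| < r'.
  move=> zr; apply: le_lt_trans zr.
  by rewrite -[q in `|_ - q|](row_mxKr p) -linearB rsubmx_norm_le.
have := H1 _ _ (lp _ _ a1) (lp _ _ b1).
have := H2 _ _ (rp _ _ a2) (rp _ _ b2).
have := H3 _ _ (rp _ _ a3) (rp _ _ b3).
rewrite -!linearB; set z := z1 - z2 => E3 E2 E1.
have lz := lsubmx_norm_le z; have rz := rsubmx_norm_le z.
rewrite mul_fibre_jac /fibre_map !(opp_row_mx, add_row_mx).
apply: row_mx_norm_le; last first.
  by apply: (le_trans E3); rewrite ler_wpM2l// ltW.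
rewrite (_ : _ - _ = (Phi (lsubmx z1) - Phi (lsubmx z2) - lsubmx z *m DPhi) -
    (S (rsubmx z1) - S (rsubmx z2) - rsubmx z *m DS)); last first.
  by apply/rowP => i; rewrite !mxE; ring.
rewrite (le_trans (ler_normB _ _))//
  [leRHS](_ : _ = r / 2 * `|z| + r / 2 * `|z|).
  by rewrite lerD// (le_trans E1, le_trans E2)// ler_wpM2l// ltW.
by rewrite -mulrDl -splitr.
Qed.

End FibreMap.

Lemma is_diff_lsubmx n1 n2 (z : R -> 'rV[R]_(n1 + n2)) t v k :
  is_diff t z ( *:%R^~ (row_mx v k)) -> is_diff t (lsubmx \o z) ( *:%R^~ v).
Proof.
move=> /curve_diffP zd; apply/curve_diffP => r r0.
apply: filterS (zd _ r0) => s; apply: le_trans => /=.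
have -> : lsubmx (z s) - lsubmx (z t) - (s - t) *: v =
    lsubmx (z s - z t - (s - t) *: row_mx v k).
  rewrite [RHS]linearB [X in _ = X - _]linearB [X in _ = _ - X]linearZ /=.
  by rewrite row_mxKl.
exact: lsubmx_norm_le.
Qed.

Lemma is_diff_rsubmx n1 n2 (z : R -> 'rV[R]_(n1 + n2)) t v k :
  is_diff t z ( *:%R^~ (row_mx v k)) -> is_diff t (rsubmx \o z) ( *:%R^~ k).
Proof.
move=> /curve_diffP zd; apply/curve_diffP => r r0.
apply: filterS (zd _ r0) => s; apply: le_trans => /=.
have -> : rsubmx (z s) - rsubmx (z t) - (s - t) *: k =
    rsubmx (z s - z t - (s - t) *: row_mx v k).
  rewrite [RHS]linearB [X in _ = X - _]linearB [X in _ = _ - X]linearZ /=.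
  by rewrite row_mxKr.
exact: rsubmx_norm_le.
Qed.

Lemma is_diff_row0 n1 n2 (w : R -> 'rV[R]_n2) t u :
  is_diff t w ( *:%R^~ u) ->
  is_diff t (fun s => row_mx (0 : 'rV[R]_n1) (w s)) ( *:%R^~ (row_mx 0 u)).
Proof.
move=> /curve_diffP wd; apply/curve_diffP => r r0.
apply: filterS (wd _ r0) => s Hs.
rewrite opp_row_mx add_row_mx scale_row_mx opp_row_mx add_row_mx.
rewrite subrr scaler0 subrr; apply: row_mx_norm_le; last exact: Hs.
by rewrite normr0 mulr_ge0// ltW.
Qed.

(** Solve phi x = s(h), t(h) = c s with velocity (v, k), where k is
d1(dphi(v)) - a and a in the kernel of ds has the difference dphi(v) - u as its
target component: then ds(k) = dphi(v) and dt(k) = u, as required. *)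
Lemma fibre_lift (H G : lieGroupoid R) (phi : groupoidMap H G) (y : obj H)
    (c : R -> obj G) t u v :
  normal_iso phi y -> c t = fobj phi y -> tangent c t u ->
  normal_eq (fobj phi y) (v *m dmf (fobj phi) y) u ->
  exists b : R -> obj H, [/\ b t = y, tangent b t v &
    \forall s \near t, same_orbit (fobj phi (b s)) (c s)].
Proof.
move=> phi_iso cty [cc cd] /orbit_tangentP[a as0 at_].
set x := fobj phi y in cty as0 at_; pose e := @unit R G x.
have ex : src e = x by exact: src_unit.
have ex' : tgt e = x by exact: tgt_unit.
have [sphi ssrc stgt] : [/\ smooth_map (fobj phi), smooth_map (@src R G) &
    smooth_map (@tgt R G)].
  by split; [exact: fobj_smooth|exact: (@src_submersion _ G).1|
             exact: (@tgt_submersion _ G).1].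
pose F := fibre_map (local_expr (fobj phi) y) (local_expr (@src R G) e)
  (local_expr (@tgt R G) e).
pose J := fibre_jac (dmf (fobj phi) y) (dmf (@src R G) e) (dmf (@tgt R G) e).
pose p := row_mx (cmap (mchart y) y) (cmap (mchart e) e).
have sF : strict_diff F p J.
  by apply: strict_diff_fibre_map; exact: smooth_strict_diff.
have Jfull : row_full J.
  apply: row_full_surj => w.
  have [v1 [k1 [E1 E2]]] := fibre_surj (lsubmx w) (rsubmx w) phi_iso.
  exists (row_mx v1 k1); rewrite mul_fibre_jac row_mxKl row_mxKr -[RHS]hsubmxK.
  by rewrite E1 E2.
pose k := v *m dmf (fobj phi) y *m dmf (@unit R G) x - a.
have kS : k *m dmf (@src R G) e = v *m dmf (fobj phi) y.
  by rewrite mulmxBl -(mulmxA (v *m _)) unit_src mulmx1 as0 subr0.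
have kT : k *m dmf (@tgt R G) e = u.
  by rewrite mulmxBl -(mulmxA (v *m _)) unit_tgt mulmx1 at_ subKr.
pose w s := row_mx (0 : 'rV[R]_(mdim (obj G))) (cmap (mchart x) (c s)).
have wd : is_diff t w ( *:%R^~ (row_mx 0 u)).
  by apply: (is_diff_row0 _ (w := cmap (mchart x) \o c)); rewrite -cty.
have wt : w t = F p.
  rewrite /F /p /fibre_map row_mxKl row_mxKr !local_expr_center ex ex' subrr.
  by rewrite /w cty.
have kJ : row_mx v k *m J = row_mx 0 u.
  by rewrite mul_fibre_jac row_mxKl row_mxKr kS kT subrr.
have [z [zt zd zF]] := solve_curve sF (mulVpmx Jfull) wt wd kJ.
have zld := is_diff_lsubmx zd; have zrd := is_diff_rsubmx zd.
pose zl := lsubmx \o z; pose zr := rsubmx \o z.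
have zlt : zl t = cmap (mchart y) y by rewrite /zl /= zt row_mxKl.
have zrt : zr t = cmap (mchart e) e by rewrite /zr /= zt row_mxKr.
have zlc : {for t, continuous zl}.
  by have [d _] := zld; exact: differentiable_continuous d.
have zrc : {for t, continuous zr}.
  by have [d _] := zrd; exact: differentiable_continuous d.
exists (fun s => cinv (mchart y) (zl s)); split.
- by rewrite zlt mchartK.
- exact: chart_curve_tangent zlt zld.
have Hphi := local_expr_curve sphi zlt zlc.
have Hsrc := local_expr_curve ssrc zrt zrc; rewrite ex in Hsrc.
have Htgt := local_expr_curve stgt zrt zrc; rewrite ex' in Htgt.
have Hc : \forall s \near t, cdom (mchart x) (c s).
  by apply: cc; rewrite cty; exact: chart_nbhs (mchart_dom _).
apply: filterS3 zF (filterI Hphi Hsrc) (filterI Htgt Hc) => s Fs [E1 E2]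
  [E3 cs].
exists (cinv (mchart e) (zr s)); rewrite -E1 -E2 -E3.
have /eq_row_mx[/eqP + ->] := Fs; rewrite subr_eq0 => /eqP <-.
by rewrite chartK.
Qed.

(** Carry c by an arrow g to a curve through phi y, with velocity u' no longer
than u. A horizontal vector v at y whose image is u' modulo the orbit exists as
[d_y phi] is onto, and its length is the norm of the class of u'. Lift by
[fibre_lift]. *)
Lemma pull_curve H G (phi : groupoidMap H G) (c : R -> obj G) t u (y : obj H) :
  riem_morita phi -> tangent c t u ->
  orbit_class (fobj phi y) = orbit_class (c t) ->
  exists b : R -> obj H, exists w, [/\ b t = y, tangent b t w,
    rnorm (eta0 H) (b t) w <= rnorm (eta0 G) (c t) u &
    \forall s \near t, orbit_map phi (orbit_class (b s)) = orbit_class (c s)].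
Proof.
move=> [[_ _ phi_iso] phi_isom] ct /esym/orbit_classP[g [sg tg]].
have [k ksrc knorm] := riem_submersion_lift (eta0_induced G) g u.
have [c' [c't c'tan c'c]] := move_curve sg ct ksrc.
pose u' := k *m dmf (@tgt R G) g.
have u'le : inner (eta0 G (fobj phi y)) u' u' <= inner (eta0 G (c t)) u u.
  by rewrite -sg -knorm -tg; exact: tgt_contracts.
have [v1 Hv1] := (phi_iso y).2 u'; rewrite -dmf_mfd in Hv1.
pose v := horizontal (eta0 H) y v1.
have Hv : normal_eq (fobj phi y) (v *m dmf (fobj phi) y) u'.
  have H1 := groupoidMap_orbit_tangent phi (horizontal_sub y v1).
  rewrite /normal_eq [X in (X <= _)%MS](_ : _ = v1 *m dmf (fobj phi) y - u' -
    (v1 - v) *m dmf (fobj phi) y); last first.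
    rewrite mulmxBl; apply/rowP => i; rewrite !mxE; ring.
  by apply: addmx_sub => //; rewrite eqmx_opp.
have c'y : c' t = fobj phi y by rewrite c't.
have [b [bt btan bc]] := fibre_lift (phi_iso y) c'y c'tan Hv.
exists b, v; split=> //.
  rewrite bt; apply: rnorm_le; apply: le_trans u'le.
  apply: (le_trans _ (normal_inner_le (fobj phi y) u')).
  rewrite -(normal_inner_congr Hv1)
    [leRHS](_ : _ = normal_inner (eta0 H) y v1 v1)//.
  by rewrite -phi_isom -!dmf_mfd.
apply: filterS2 bc c'c => s Hb Hc; rewrite orbit_mapE.
transitivity (orbit_class (c' s)); first exact/orbit_classP.
by apply/esym/orbit_classP.
Qed.

(** * First-order estimates give the normal distance *)
(** The distance from y0 to the orbit q, when its second argument is moved. *)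
(** One end is kept fixed, so that the distance to a moving orbit is a function
of time, to which [growth_le_integral] applies. *)
Definition dist_from G (y0 : obj G) (q : orbit_space G) : \bar R :=
  chain_dist y0 (orbit_rep q).

Lemma path_connected (M : manifold R) (g : riemMetric M) x y L :
  pw_path_length g x y L -> connected_component [set: M] x y.
Proof.
elim=> [|L' gamma U oU sub [gc _] _ IH].
  exact: connected_component_refl.
apply: connected_component_trans IH _.
apply: (@connected_component_max _ _ (gamma @` `[0%R, 1%R])) => //.
- by exists 0 => //; rewrite /= in_itv/= lexx ler01.
- apply: connected_continuous_connected; first exact: segment_connected.
  by apply: continuous_in_subspaceT => t; rewrite inE /= => t01; apply: gc;
    exact: sub.
- by exists 1 => //; rewrite /= in_itv/= lexx ler01.
Qed.

Lemma dist_from_orbit G (y0 : obj G) : (dist_from y0 (orbit_class y0) <= 0)%E.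
Proof.
apply: ereal_inf_lbound.
exists 0%N, (fun i => if i == 0%N then y0 else orbit_rep (orbit_class y0)).
split; last by rewrite big_geq.
split=> // [[|i]|[|i]]; rewrite ?ltn0 ?andbF// => _ /=.
by apply/orbit_classP; rewrite orbit_repK.
Qed.

Lemma path_length_ge0 (M : manifold R) (g : riemMetric M) x y L :
  pw_path_length g x y L -> 0 <= L.
Proof.
elim=> // L' gamma U _ _ _ _ L0; rewrite addr_ge0//.
by apply: Rintegral_ge0 => t _; exact: sqrtr_ge0.
Qed.

Lemma riem_dist_ge0 (M : manifold R) (g : riemMetric M) x y :
  (0 <= riem_dist g x y)%E.
Proof.
by apply/ereal_infP => _ [L /path_length_ge0 L0 <-]; rewrite lee_fin.
Qed.

Lemma dist_from_ge0 G (y0 : obj G) q : (0 <= dist_from y0 q)%E.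
Proof.
apply/ereal_infP => _ [n [c [_ ->]]].
by apply: sume_ge0 => i _; exact: riem_dist_ge0.
Qed.

(** Extend a chain ending in the orbit of y by one step, along the path. *)
Lemma dist_from_path G (y0 y z : obj G) L : pw_path_length (eta0 G) y z L ->
  (dist_from y0 (orbit_class z) <= dist_from y0 (orbit_class y) + L%:E)%E.
Proof.
move=> yzL; rewrite -leeBlDr//;
  apply/ereal_infP => l [n [c [[c0 cn cO cC] ->]]].
rewrite leeBlDr//.
have yr : same_orbit (orbit_rep (orbit_class y)) y.
  by apply/orbit_classP; rewrite orbit_repK.
have zr : same_orbit z (orbit_rep (orbit_class z)).
  by apply/orbit_classP; rewrite orbit_repK.
(* Up to the index n.*2 the chain is kept. It then enters the orbit of y at y
   itself, goes to z, and ends at the representative of the orbit of z. *)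
pose c' i := if (i <= n.*2)%N then c i else if i == n.*2.+1 then y
  else if i == n.*2.+2 then z else orbit_rep (orbit_class z).
have c'_old i : (i <= n.*2)%N -> c' i = c i by rewrite /c' => ->.
have c'1 : c' n.*2.+1 = y by rewrite /c' ltnn eqxx.
have c'2 : c' n.*2.+2 = z by rewrite /c' 2?ifN ?eqxx//; lia.
have c'3 : c' n.*2.+3 = orbit_rep (orbit_class z) by rewrite /c' !ifN//; lia.
apply: (@le_trans _ _
  (\sum_(1 <= i < n.+2) riem_dist (eta0 G) (c' i.*2.-1) (c' i.*2))%E).
  apply: ereal_inf_lbound; exists n.+1, c'; split=> //; split=> [||i|i].
  - by rewrite c'_old.
  - by rewrite doubleS c'3.
  - rewrite leq_eqVlt => /predU1P[->|]; first by rewrite doubleS c'2 c'3.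
    rewrite ltnS leq_eqVlt => /predU1P[->|iltn].
      rewrite c'1 c'_old//; apply/orbit_classP.
      transitivity (orbit_class (c n.*2.+1)).
        by apply/orbit_classP; exact: cO.
      by rewrite cn; apply/orbit_classP.
    by rewrite !c'_old; [apply: cO; exact: ltnW|lia|lia].
  - move=> /andP[i0]; rewrite leq_eqVlt => /predU1P[->|iltn].
      by rewrite doubleS /= c'1 c'2; exact: path_connected yzL.
    by rewrite !c'_old; [apply: cC; rewrite i0|lia|lia].
rewrite big_nat_recr//= doubleS /= c'1 c'2; apply: leeD.
  rewrite le_eqVlt; apply/orP; left; apply/eqP;
    apply: eq_big_nat => i /andP[i0 iltn].
  by rewrite !c'_old//; lia.
by apply: ereal_inf_lbound; exists L.
Qed.

Lemma dist_from_riem_dist G (y0 y z : obj G) r :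
  (riem_dist (eta0 G) y z <= r%:E)%E ->
  (dist_from y0 (orbit_class z) <= dist_from y0 (orbit_class y) + r%:E)%E.
Proof.
move=> yzr; apply/lee_addgt0Pr => e e0; rewrite -addeA -EFinD.
have : (riem_dist (eta0 G) y z < (r + e)%:E)%E.
  by rewrite (le_lt_trans yzr)// lte_fin ltrDl.
move=> /ereal_inf_lt[_ [L yzL <-]]; rewrite lte_fin => Lre.
apply: (le_trans (dist_from_path y0 yzL)).
by rewrite leeD2l// lee_fin ltW.
Qed.

(** As b depends on t, this says nothing of lifting a whole curve: it is the
rate of change of distances at the time t which b controls. *)
Definition infinitesimally_short H G (psi : orbit_space H -> orbit_space G) :=
  forall (c : R -> obj H) t v, tangent c t v ->
  exists b : R -> obj G, exists w, [/\ tangent b t w,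
    rnorm (eta0 G) (b t) w <= rnorm (eta0 H) (c t) v &
    \forall s \near t, orbit_class (b s) = psi (orbit_class (c s))].

Section Short.
Variables (H G : riemGroupoid R) (psi : orbit_space H -> orbit_space G).
Hypothesis psi_short : infinitesimally_short psi.

Lemma short_local (c : R -> obj H) t v e y0 : tangent c t v -> 0 < e ->
  \forall s \near t,
    (dist_from y0 (psi (orbit_class (c s))) <=
      dist_from y0 (psi (orbit_class (c t))) +
      ((rnorm (eta0 H) (c t) v + e) * `|s - t|)%:E)%E /\
    (dist_from y0 (psi (orbit_class (c t))) <=
      dist_from y0 (psi (orbit_class (c s))) +
      ((rnorm (eta0 H) (c t) v + e) * `|s - t|)%:E)%E.
Proof.
move=> ct e0; have [b [w [bw wv bc]]] := psi_short ct.
have bct := nbhs_singleton bc.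
apply: filterS2 bc (tangent_dist (eta0 G) bw e0) => s <- [H1 H2].
rewrite -[psi (orbit_class (c t))]bct.
have le r : (r <= ((rnorm (eta0 G) (b t) w + e) * `|s - t|)%:E)%E ->
    (r <= ((rnorm (eta0 H) (c t) v + e) * `|s - t|)%:E)%E.
  by move=> /le_trans; apply; rewrite lee_fin ler_wpM2r// lerD2r.
by split; apply: dist_from_riem_dist; exact: le.
Qed.

Lemma short_curve (U : set R) (c : R -> obj H) y0 : open U -> `[0, 1] `<=` U ->
  smooth_curve_on U c ->
  (dist_from y0 (psi (orbit_class (c 1%R))) <=
   dist_from y0 (psi (orbit_class (c 0%R))) + (curve_length (eta0 H) c)%:E)%E.
Proof.
move=> oU sub sc.
apply: (growth_le_integral
  (F := fun t => dist_from y0 (psi (orbit_class (c t))))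
  (f := speed (eta0 H) c)) => [t t01|t t01 e e0].
  by apply: speed_continuous oU sc _; exact: sub.
have ct := smooth_curve_tangent oU sc (sub _ t01).
apply: filterS (short_local y0 ct e0) => s [H1 H2]; split=> [ts|st].
  by move: H1; rewrite ger0_norm// subr_ge0.
by move: H2; rewrite ler0_norm ?subr_le0// opprB.
Qed.

Lemma short_path x y L y0 : pw_path_length (eta0 H) x y L ->
  (dist_from y0 (psi (orbit_class y)) <=
   dist_from y0 (psi (orbit_class x)) + L%:E)%E.
Proof.
elim=> [|L' c U oU sub sc _ IH]; first by rewrite adde0.
apply: (le_trans (short_curve y0 oU sub sc)).
by rewrite EFinD addeA leeD2r.
Qed.

(** When the first term on the right is infinite there is nothing to subtract,
and the bound is trivial. *)
Lemma short_riem_dist x y y0 :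
  (dist_from y0 (psi (orbit_class y)) <=
   dist_from y0 (psi (orbit_class x)) + riem_dist (eta0 H) x y)%E.
Proof.
have sp L : pw_path_length (eta0 H) x y L -> _ := @short_path x y L y0.
have d0 := riem_dist_ge0 (eta0 H) x y.
have := dist_from_ge0 y0 (psi (orbit_class x)).
case: (dist_from y0 (psi (orbit_class x))) sp => [r||//] sp _.
  rewrite -leeBlDl//; apply/ereal_infP => _ [L /sp Hs <-].
  by rewrite leeBlDl.
by rewrite addye ?leey// -ltNye (lt_le_trans _ d0)// ltNyr.
Qed.

Lemma short_chain x y n c y0 : chain x y n c ->
  (dist_from y0 (psi (orbit_class y)) <= dist_from y0 (psi (orbit_class x)) +
   \sum_(1 <= i < n.+1) riem_dist (eta0 H) (c i.*2.-1) (c i.*2))%E.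
Proof.
move=> [<- <- cO _].
suff : forall k, (k <= n)%N -> (dist_from y0 (psi (orbit_class (c k.*2.+1))) <=
  dist_from y0 (psi (orbit_class (c 0%N))) +
   \sum_(1 <= i < k.+1) riem_dist (eta0 H) (c i.*2.-1) (c i.*2))%E.
  by apply.
elim=> [_|k IH kn].
  by rewrite big_geq// adde0 (_ : orbit_class (c 1) = orbit_class (c 0))//;
    apply/esym/orbit_classP; exact: (cO 0%N).
have <- : orbit_class (c k.+1.*2) = orbit_class (c k.+1.*2.+1).
  by apply/orbit_classP; exact: cO.
apply: (le_trans (short_riem_dist (c k.*2.+1) _ y0)).
rewrite big_nat_recr//= addeA leeD2r// IH//.
exact: ltnW.
Qed.

Lemma short_normal_dist p q :
  (normal_dist (psi p) (psi q) <= normal_dist p q)%E.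
Proof.
apply/ereal_infP => _ [n [c [ch ->]]].
have := short_chain (orbit_rep (psi p)) ch; rewrite !orbit_repK => /le_trans;
  apply.
rewrite -[leRHS]add0e leeD2r//.
have := dist_from_orbit (orbit_rep (psi p)); by rewrite orbit_repK.
Qed.

End Short.

(** Neither the map induced by phi nor its inverse psi increases distances. *)
Lemma morita_normal_dist H G (phi : groupoidMap H G) psi : riem_morita phi ->
  cancel (orbit_map phi) psi -> cancel psi (orbit_map phi) ->
  forall p q, normal_dist (orbit_map phi p) (orbit_map phi q) = normal_dist p q.
Proof.
move=> phiM phiK psiK p q; apply/le_anti/andP; split.
  apply: short_normal_dist => c t v ct; exact: push_curve phiM ct.
rewrite -{1}[p]phiK -{1}[q]phiK.
apply: short_normal_dist => c t u ct.
have [|b [w [_ bw wu bc]]] :=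
  pull_curve (y := orbit_rep (psi (orbit_class (c t)))) phiM ct.
  by rewrite -orbit_mapE orbit_repK psiK.
by exists b, w; split=> //; apply: filterS bc => s <-; rewrite phiK.
Qed.

End OrbitMotion.

Theorem corollary3p12 (R : realType) (G G' H : riemGroupoid R)
    (phi : groupoidMap H G) (phi' : groupoidMap H G')
    (hphi : riem_morita phi) (hphi' : riem_morita phi') :
  exists psi : orbit_space G -> orbit_space H,
    [/\ cancel (orbit_map phi) psi,
        cancel psi (orbit_map phi),
        bijective (orbit_map phi' \o psi)
      & forall p q : orbit_space G,
          normal_dist ((orbit_map phi' \o psi) p) ((orbit_map phi' \o psi) q)
          = normal_dist p q].
Proof.
have [[[_ [psi [_ phiK psiK]]] _ _] _] := hphi.
have [[[_ [psi' [_ phiK' psiK']]] _ _] _] := hphi'.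
exists psi; split=> //.
  by exists (orbit_map phi \o psi') => p /=; rewrite ?phiK' ?psiK ?phiK ?psiK'.
move=> p q /=; rewrite (morita_normal_dist hphi' phiK' psiK').
by rewrite -(morita_normal_dist hphi phiK psiK) !psiK.
Qed.
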